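(* Let $n\ge3$. The isolated subsemigroups of $\mathcal{PI}^{\ast}_n$ are exactly the following: (1) $\mathcal{I}^{\ast}_n$, $\mathcal{I}^{\ast}_n\setminus\mathcal{S}_n$, $\mathcal{S}_n$, and $G(e)$ for $e$ an idempotent of $\mathcal{I}^{\ast}_n$ of rank $n-1$; (2) for each $t\in\{1,\dots,n\}$ and $Y=\{1,\dots,n\}\setminus\{t\}$: $\mathcal{I}^{\ast}_Y$, $\mathcal{I}^{\ast}_Y\setminus\mathcal{S}_Y$, $\mathcal{S}_Y$, and $G(e)$ for $e$ an idempotent of $\mathcal{I}^{\ast}_Y$ of rank $n-2$; (3) $\mathcal{PI}^{\ast}_n$ and $\mathcal{PI}^{\ast}_n\setminus\mathcal{S}_n$.
   Context: Let $X=\{1,\dots,n\}$, $X'=\{1',\dots,n'\}$. $\mathcal{PI}^{\ast}_n$ is the set of partitions of $X\cup X'$ each of whose blocks is a singleton (point) or a generalised line (a set meeting both $X$ and $X'$), with product $\star$: with $X''$ a third copy of $X$, regard $\alpha$ as a partition of $X\cup X''$ and $\beta$ as a partition of $X''\cup X'$, let $\sim$ be the equivalence on $X\cup X''\cup X'$ generated by the blocks of both; $\alpha\star\beta$ is the partition of $X\cup X'$ in which distinct $u,v$ are in one block iff $u\sim v$ and the $\sim$-class of $u$ contains no singleton block of $\alpha$ or $\beta$. Rank = number of generalised lines. $\mathcal{I}^{\ast}_n$ = elements with no points; $\mathcal{S}_n$ = group of units (all blocks of the form $\{x,\pi(x)'\}$, $\pi$ a permutation). For $Y=X\setminus\{t\}$,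 $\mathcal{I}^{\ast}_Y$ is the set of elements of $\mathcal{PI}^{\ast}_n$ whose points are exactly $\{t\}$ and $\{t'\}$ (so the generalised lines partition $Y\cup Y'$), and $\mathcal{S}_Y$ the set of those whose other blocks are $\{y,\pi(y)'\}$ for a permutation $\pi$ of $Y$; these are subsemigroups. $G(e)$ is the $\mathcal{H}$-class (in $\mathcal{PI}^{\ast}_n$) of the idempotent $e$. A subsemigroup $T$ of $S$ is isolated if for all $a\in S$, $k\ge 1$, $a^k\in T$ implies $a\in T$. *)

(* Defs.v *)
From mathcomp Require Import all_boot all_fingroup.
Set Implicit Arguments. Unset Strict Implicit. Unset Printing Implicit Defensive.

Section PIstar.
Variable n : nat.

(* X = inl i (i = 1..n), X' = inr i (i = 1'..n'). *)
Definition pt := ('I_n + 'I_n)%type.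
Definition elt := {set {set pt}}.

Definition isLine (B : {set pt}) : bool :=
  [exists i : 'I_n, inl i \in B] && [exists j : 'I_n, inr j \in B].
Definition isPoint (B : {set pt}) : bool := #|B| == 1.

Definition isPI (a : elt) : bool :=
  partition a [set: pt] && [forall B in a, isPoint B || isLine B].
Definition PIset : {set elt} := [set a | isPI a].

(* three copies: X = inl (inl i), X'' = inl (inr i), X' = inr i *)
Definition pt3 := ('I_n + 'I_n + 'I_n)%type.
Definition embA (x : pt) : pt3 := match x with inl i => inl (inl i) | inr i => inl (inr i) end.
Definition embB (x : pt) : pt3 := match x with inl i => inl (inr i) | inr i => inr i end.
Definition embO (x : pt) : pt3 := match x with inl i => inl (inl i) | inr i => inr i end.

Definition prel (a b : elt) : rel pt3 := fun u v =>
  [exists B in a, (u \in embA @: B) && (v \in embA @: B)] ||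
  [exists B in b, (u \in embB @: B) && (v \in embB @: B)].
Definition pcls (a b : elt) (u : pt3) : {set pt3} := [set v | connect (prel a b) u v].
Definition pgood (a b : elt) (u : pt3) : bool :=
  ~~ [exists B in a, isPoint B && (embA @: B \subset pcls a b u)] &&
  ~~ [exists B in b, isPoint B && (embB @: B \subset pcls a b u)].
Definition pblk (a b : elt) (x : pt) : {set pt} :=
  [set y | (y == x) || (pgood a b (embO x) && connect (prel a b) (embO x) (embO y))].
Definition star (a b : elt) : elt := [set pblk a b x | x : pt].

(* pw a k = a^(k+1) *)
Fixpoint pw (a : elt) (k : nat) : elt :=
  match k with 0 => a | k.+1 => star a (pw a k) end.

Definition rank (a : elt) : nat := #|[set B in a | isLine B]|.
Definition idem (e : elt) : bool := star e e == e.

Definition Iset : {set elt} := [set a in PIset | [forall B in a, ~~ isPoint B]].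
Definition Sset : {set elt} :=
  [set a | [exists p : {perm 'I_n}, a == [set [set inl x; inr (p x)] | x : 'I_n]]].

Definition IYset (t : 'I_n) : {set elt} :=
  [set a in PIset | [set B in a | isPoint B] == [set [set inl t]; [set inr t]]].
Definition SYset (t : 'I_n) : {set elt} :=
  [set a | [exists p : {perm 'I_n}, (p t == t) &&
     (a == [set [set inl x; inr (p x)] | x in [set~ t]] :|: [set [set inl t]; [set inr t]])]].

Definition inRideal (a b : elt) : bool := (a == b) || [exists x in PIset, a == star b x].
Definition inLideal (a b : elt) : bool := (a == b) || [exists x in PIset, a == star x b].
Definition Hrel (a b : elt) : bool :=
  [&& inRideal a b, inRideal b a, inLideal a b & inLideal b a].
Definition Gcl (e : elt) : {set elt} := [set a in PIset | Hrel a e].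

Definition subsemigroup (A : {set elt}) : Prop :=
  A \subset PIset /\ A != set0 /\ {in A &, forall a b, star a b \in A}.
Definition isolated (A : {set elt}) : Prop :=
  forall a, a \in PIset -> forall k, pw a k \in A -> a \in A.

End PIstar.

(* Main.v *)
Require Import Defs.
From mathcomp Require Import all_boot all_fingroup.

(** An element [a] acts as a partial injection of the power set of X, sending A to B when A ∪ B' is a union of
generalised lines of [a] (relation [R a A B]).  This turns the product into composition of relations and determines
[a], so one works in an inverse semigroup of partial injections; idempotents are partial identities, given by their
domains [D e], and correspond to equivalence relations on X with an adjoined zero whose class is the set of points.

An isolated subsemigroup is determined by its idempotents, since every element has an idempotent power.  Let [m] be
the least idempotent of such a subsemigroup T.  If e ∈ T and [a] is an isomorphism between two refinements of [e]
whose join is [e], compatible with [e], then some power of [a] is [e], so [a], its inverse and hence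
the refinements lie in T: classes of [e] with at least three points, or two nonzero nontrivial classes, can be split
inside T.  Conversely, conjugating [m] by permutations of the classes of a finer idempotent of T cannot change the
kernel of [m], which forces [m] to have a single class on its support unless it is an identity or has rank one less.
In the single-class case every nonidentity idempotent with the same support (every nonidentity idempotent at all, if
[m] has at least two points in X) is reached from [m] by repeated splitting. *)

Set Implicit Arguments. Unset Strict Implicit. Unset Printing Implicit Defensive.

(** * Elements as partial injections of the power set *)

Section Semantics.
Variable n : nat.
Implicit Types (a b c e : elt n) (A B C : {set 'I_n}) (v w : pt n).

Definition glue A B : {set pt n} :=
  [set v | match v with inl x => x \in A | inr y => y \in B end].

Definition sat a (W : {set pt n}) : bool :=
  [forall K in a, ~~ isPoint K && (K \subset W) || [disjoint K & W]].

Definition R a A B : bool := sat a (glue A B).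

Lemma satP a (W : {set pt n}) :
  reflect (forall K, K \in a -> forall v, v \in K -> v \in W ->
             ~~ isPoint K /\ K \subset W) (sat a W).
Proof.
apply: (iffP forall_inP) => [H K aK v vK vW|H K aK].
  case/orP: (H K aK) => [/andP[]//|/disjointFr /(_ vK)]; by rewrite vW.
case: (pickP [pred v | (v \in K) && (v \in W)]) => [v /andP[vK vW]|no].
  by have [-> ->] := H K aK v vK vW.
apply/orP; right; apply/pred0P => v; exact: no.
Qed.

(* [mk f g] is the element whose lines are the common colour classes of [f] on X and [g] on X', the value [None] marking points; [f] and [g] must use the same colours ([balanced]). *)
Section Coloring.
Variable L : eqType.
Implicit Types (f g : 'I_n -> option L) (phi : pt n -> option L).

Definition cblk phi v : {set pt n} :=
  [set w | (w == v) || (phi v != None) && (phi w == phi v)].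
Definition cpart phi : elt n := [set cblk phi v | v : pt n].

Definition both f g v := match v with inl x => f x | inr y => g y end.
Definition mk f g : elt n := cpart (both f g).

Definition balanced f g :=
  (forall x l, f x = Some l -> exists y, g y = Some l) /\
  (forall y l, g y = Some l -> exists x, f x = Some l).

Lemma cblk_id phi v : v \in cblk phi v.
Proof. by rewrite inE eqxx. Qed.

Lemma cblk_eq phi v w : w \in cblk phi v -> cblk phi w = cblk phi v.
Proof.
rewrite inE => /orP[/eqP->//|/andP[nv /eqP ew]].
apply/setP => z; rewrite !inE ew nv /=.
case: (phi z =P phi v) => [_|nz]; rewrite ?orbT ?orbF //.
by apply/eqP/eqP => ez; case: nz; rewrite ez.
Qed.

Lemma cpart_partition phi : partition (cpart phi) [set: pt n].
Proof.
apply/and3P; split.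
- apply/eqP/setP => v; rewrite inE; apply/bigcupP.
  by exists (cblk phi v); [apply: imset_f | apply: cblk_id].
- apply/trivIsetP => K1 K2 /imsetP[v _ ->] /imsetP[w _ ->] ne.
  apply/pred0P => z /=; apply/negbTE/negP => /andP[/cblk_eq e1 /cblk_eq e2].
  by rewrite -e1 e2 eqxx in ne.
- by apply/imsetP => -[v _ /setP/(_ v)]; rewrite cblk_id inE.
Qed.

Lemma cblk_None phi v : phi v = None -> cblk phi v = [set v].
Proof. by move=> e; apply/setP => w; rewrite !inE e /= orbF. Qed.

(** By balance the colour of [v] occurs on both sides, so its block meets X and X' and has at least
    two elements. *)
Lemma cblk_line f g v : balanced f g -> both f g v != None ->
  isLine (cblk (both f g) v) && ~~ isPoint (cblk (both f g) v).
Proof.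
move=> [fg gf] nv.
have [x xK] : exists x, inl x \in cblk (both f g) v.
  case: v nv => [x|y] nv; first by exists x; apply: cblk_id.
  case E : (both _ _ _) nv => [l|//] _; have [x fx] := gf _ _ E.
  by exists x; rewrite inE E /= fx eqxx.
have [y yK] : exists y, inr y \in cblk (both f g) v.
  case: v nv xK => [x0|y0] nv xK; last by exists y0; apply: cblk_id.
  case E : (both _ _ _) nv => [l|//] _; have [y gy] := fg _ _ E.
  by exists y; rewrite inE E /= gy eqxx.
apply/andP; split.
  by apply/andP; split; apply/existsP; [exists x|exists y].
apply/negP => /cards1P[z ez]; move: xK yK; rewrite ez !inE => /eqP<- /eqP//.
Qed.

Lemma mk_PI f g : balanced f g -> mk f g \in PIset n.
Proof.
move=> bal; rewrite inE /isPI cpart_partition /=.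
apply/forall_inP => K /imsetP[v _ ->].
have [e|nv] := eqVneq (both f g v) None.
  by rewrite cblk_None // /isPoint cards1.
by have /andP[->] := cblk_line bal nv; rewrite orbT.
Qed.

(** Lines are whole colour classes and vertices coloured [None] are points, so choosing a union of
    lines amounts to choosing a set [S] of colours. *)
Lemma sat_mk f g (W : {set pt n}) : balanced f g ->
  sat (mk f g) W <-> exists S : pred L, forall v, (v \in W) = oapp S false (both f g v).
Proof.
move=> bal; split=> [/satP H|[S HS]].
  exists (fun l => [exists v in W, both f g v == Some l]) => v.
  have Hv := H (cblk (both f g) v) (imset_f _ isT) v (cblk_id _ _).
  apply/idP/idP => [vW|].
    have := Hv vW; case E : (both f g v) => [l|] /=.
      by move=> _; apply/existsP; exists v; rewrite vW E eqxx.
    by rewrite cblk_None // /isPoint cards1 => -[].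
  case E : (both f g v) => [l|//] /= /existsP[w /andP[wW /eqP ew]].
  have [_ /subsetP] := H (cblk (both f g) w) (imset_f _ isT) w (cblk_id _ _) wW.
  by apply; rewrite inE ew E eqxx orbT.
apply/satP => K /imsetP[v _ ->] w wK; rewrite HS => wW.
have nv : both f g v != None.
  move: wK wW; rewrite inE => /orP[/eqP->|/andP[-> //]].
  by case: (both f g v).
have /andP[_ ->] := cblk_line bal nv; split=> //.
apply/subsetP => z zK; rewrite HS; move: zK wK wW; rewrite !inE nv /=.
by case/orP=> /eqP->; case/orP => /eqP->.
Qed.

Lemma R_mk f g A B : balanced f g ->
  R (mk f g) A B <-> exists S : pred L,
    (forall x, (x \in A) = oapp S false (f x)) /\
    (forall y, (y \in B) = oapp S false (g y)).
Proof.
move=> bal; split=> [/(sat_mk _ bal)[S H]|[S [H1 H2]]].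
  by exists S; split=> x; [have := H (inl x)|have := H (inr x)]; rewrite inE.
by apply/(sat_mk _ bal); exists S => -[x|y]; rewrite inE /= ?H1 ?H2.
Qed.

End Coloring.

(** Each vertex on a line takes that line as its colour; a line meets both sides, which gives
    balance. *)
Lemma PI_mk a : a \in PIset n ->
  exists f g : 'I_n -> option {set pt n}, balanced f g /\ a = mk f g.
Proof.
rewrite inE => /andP[pa /forall_inP la].
have cov v : v \in cover a by rewrite (cover_partition pa) inE.
have tr := partition_trivIset pa.
pose phi v := if isLine (pblock a v) then Some (pblock a v) else None.
have pbin v : pblock a v \in a by apply: pblock_mem.
have vpb v : v \in pblock a v by rewrite mem_pblock.
have eqb v w : w \in pblock a v -> pblock a w = pblock a v.
  by move=> h; apply: same_pblock.
exists (phi \o inl), (phi \o inr); split.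
  split=> x l /=; rewrite /phi; case: ifP => // lx; case/andP: (lx) => /existsP[z hz] /existsP[y hy] [<-].
    by exists y; rewrite (eqb _ _ hy) lx.
  by exists z; rewrite (eqb _ _ hz) lx.
have E v : cblk (both (phi \o inl) (phi \o inr)) v = pblock a v.
  have Eb w : both (phi \o inl) (phi \o inr) w = phi w by case: w.
  apply/setP => w; rewrite inE !Eb /phi.
  case lv : (isLine (pblock a v)) => /=.
    apply/orP/idP => [[/eqP->//|]|h]; last by right; rewrite (eqb _ _ h) lv.
    case: ifP => // _ /eqP [<-]; exact: vpb.
  move: (la _ (pbin v)); rewrite lv orbF orbF => /cards1P[z ez].
  by move: (vpb v); rewrite ez !inE => /eqP->.
apply/setP => K; apply/idP/imsetP => [aK|[v _ ->]]; last by rewrite E.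
have [v vK] : exists v, v \in K.
  by apply/set0Pn; apply: contraTneq aK => ->; case/and3P: pa.
by exists v => //; rewrite E; apply/esym/def_pblock.
Qed.

(** * The product as composition of relations *)

Section Product.
Variables a b : elt n.
Hypotheses (aP : a \in PIset n) (bP : b \in PIset n).

(* The product is itself given by a colouring: a vertex of the three-layer graph is coloured by its component, unless that component contains a point. *)
Definition ccol (u : pt3 n) : option {set pt3 n} :=
  if pgood a b u then Some (pcls a b u) else None.

Lemma pcls_sym : connect_sym (prel a b).
Proof.
apply: sym_connect_sym => u t; rewrite /prel.
by congr (_ || _); apply: eq_existsb => K; congr (_ && _); rewrite andbC.
Qed.

Lemma pcls_eq (u v : pt3 n) : connect (prel a b) u v -> pcls a b u = pcls a b v.
Proof.
by move=> uv; apply/setP => t; rewrite !inE (same_connect pcls_sym uv).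
Qed.

Lemma ccol_eq (u v : pt3 n) : connect (prel a b) u v -> ccol u = ccol v.
Proof. by move=> /pcls_eq e; rewrite /ccol /pgood e. Qed.

Lemma ccolA K v w : K \in a -> v \in K -> w \in K -> ccol (embA v) = ccol (embA w).
Proof.
move=> aK vK wK; apply/ccol_eq/connect1/orP; left.
by apply/exists_inP; exists K => //; rewrite !imset_f.
Qed.

Lemma ccolB K v w : K \in b -> v \in K -> w \in K -> ccol (embB v) = ccol (embB w).
Proof.
move=> bK vK wK; apply/ccol_eq/connect1/orP; right.
by apply/exists_inP; exists K => //; rewrite !imset_f.
Qed.

Lemma ccolA_point K v : K \in a -> isPoint K -> v \in K -> ccol (embA v) = None.
Proof.
move=> aK pK vK; rewrite /ccol /pgood; case: exists_inP => // -[].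
exists K => //; rewrite pK; case/cards1P: pK vK => z ->; rewrite inE => /eqP->.
by rewrite imset_set1 sub1set inE connect0.
Qed.

Lemma ccolB_point K v : K \in b -> isPoint K -> v \in K -> ccol (embB v) = None.
Proof.
move=> bK pK vK; rewrite /ccol /pgood andbC; case: exists_inP => // -[].
exists K => //; rewrite pK; case/cards1P: pK vK => z ->; rewrite inE => /eqP->.
by rewrite imset_set1 sub1set inE connect0.
Qed.

Lemma star_mk : star a b = mk (fun x => ccol (inl (inl x))) (fun y => ccol (inr y)).
Proof.
rewrite /star /mk /cpart; apply: eq_imset => v; apply/setP => w; rewrite !inE.
have E u : both (fun x => ccol (inl (inl x))) (fun y => ccol (inr y)) u = ccol (embO u).
  by case: u.
rewrite !E; congr (_ || _); rewrite /ccol; case gv : (pgood a b (embO v)) => //=.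
apply/idP/eqP => [/ccol_eq|]; first by rewrite /ccol gv => <-.
by case: ifP => // _ [] /setP/(_ (embO w)); rewrite !inE connect0.
Qed.

Lemma PI_block c (v : pt n) : c \in PIset n ->
  exists2 K, K \in c & v \in K /\ (isPoint K \/
     (exists x, inl x \in K) /\ (exists y, inr y \in K)).
Proof.
rewrite inE => /andP[pc /forall_inP lc].
have cv : v \in cover c by rewrite (cover_partition pc) inE.
exists (pblock c v); first exact: pblock_mem.
rewrite mem_pblock; split=> //.
case/orP: (lc _ (pblock_mem cv)) => [->|/andP[/existsP h1 /existsP h2]]; first by left.
by right.
Qed.

(** A colour other than [None] passes from X through a block of [a] to X'' and on through a block of
    [b] to X', or the other way round; a point met on the way would have spoilt the component. *)
Lemma star_balanced : balanced (fun x => ccol (inl (inl x))) (fun y => ccol (inr y)).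
Proof.
split=> x l Hx.
  have [K aK [xK [pK|[_ [y yK]]]]] := PI_block (inl x) aP.
    by have := ccolA_point aK pK xK; rewrite /= Hx.
  have e1 := ccolA aK xK yK; rewrite /= Hx in e1.
  have [M bM [yM [pM|[_ [z zM]]]]] := PI_block (inl y) bP.
    by have := ccolB_point bM pM yM; rewrite /= -e1.
  by exists z; have := ccolB bM yM zM; rewrite /= -e1.
have [K bK [xK [pK|[[y yK] _]]]] := PI_block (inr x) bP.
  by have := ccolB_point bK pK xK; rewrite /= Hx.
have e1 := ccolB bK xK yK; rewrite /= Hx in e1.
have [M aM [yM [pM|[[z zM] _]]]] := PI_block (inr y) aP.
  by have := ccolA_point aM pM yM; rewrite /= -e1.
by exists z; have := ccolA aM yM zM; rewrite /= -e1.
Qed.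

Lemma star_PI : star a b \in PIset n.
Proof. by rewrite star_mk; apply/mk_PI/star_balanced. Qed.

Lemma R_star A C : reflect (exists B, R a A B /\ R b B C) (R (star a b) A C).
Proof.
rewrite star_mk; apply: (iffP idP) => [/(R_mk _ _ star_balanced)[S [SA SC]]|[B [aAB bBC]]].
  (* The intermediate set collects the vertices of X'' whose component is selected by [S]. *)
  exists [set y | oapp S false (ccol (inl (inr y)))]; split; apply/satP => K cK v vK vW.
    have Ew w : (w \in glue A [set y | oapp S false (ccol (inl (inr y)))])
                 = oapp S false (ccol (embA w)).
      by case: w => w; rewrite !inE.
    split; last by apply/subsetP => w wK; move: vW; rewrite !Ew (ccolA cK vK wK).
    by apply/negP => pK; move: vW; rewrite Ew (ccolA_point cK pK vK).
  have Ew w : (w \in glue [set y | oapp S false (ccol (inl (inr y)))] C)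
               = oapp S false (ccol (embB w)).
    by case: w => w; rewrite !inE.
  split; last by apply/subsetP => w wK; move: vW; rewrite !Ew (ccolB cK vK wK).
  by apply/negP => pK; move: vW; rewrite Ew (ccolB_point cK pK vK).
(* [W] is the union of [A], [B] and [C] placed in the three layers. It is closed under [prel], hence
   a union of components. *)
pose W : {set pt3 n} := [set u | match u with
  | inl (inl x) => x \in A | inl (inr x) => x \in B | inr x => x \in C end].
have WA w : (embA w \in W) = (w \in glue A B) by case: w => w; rewrite !inE.
have WB w : (embB w \in W) = (w \in glue B C) by case: w => w; rewrite !inE.
have imp c D E K v w : sat c (glue D E) -> K \in c -> v \in K -> w \in K ->
    v \in glue D E -> w \in glue D E.
  by move=> /satP H cK vK wK vW; have [_ /subsetP] := H K cK v vK vW; apply.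
have cl : closed (prel a b) W.
  apply: (intro_closed pcls_sym) => u t /orP[] /exists_inP[K cK]
    /andP[/imsetP[u' uK ->] /imsetP[t' vK ->]].
    by rewrite !WA; apply: imp aAB cK uK vK.
  by rewrite !WB; apply: imp bBC cK uK vK.
(* No spoilt component lies in [W]: it contains a point of [a] or [b], and [sat] keeps points out.
   So [W] is described by colours. *)
have good u : (u \in W) = oapp (fun T : {set pt3 n} => [exists t in T, t \in W]) false (ccol u).
  rewrite /ccol; case: ifPn => /= [_|].
    apply/idP/exists_inP => [uW|[t]]; first by exists u => //; rewrite inE connect0.
    by rewrite inE => /(closed_connect cl) ->.
  rewrite negb_and !negbK => /orP[] /exists_inP[K cK /andP[pK /subsetP sK]].
    case/cards1P: (pK) => v eK; have vK : v \in K by rewrite eK inE.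
    have := sK _ (imset_f _ vK); rewrite inE => /(closed_connect cl) ->; rewrite WA.
    by apply/negP => vW; have [] := satP _ _ aAB K cK v vK vW; rewrite pK.
  case/cards1P: (pK) => v eK; have vK : v \in K by rewrite eK inE.
  have := sK _ (imset_f _ vK); rewrite inE => /(closed_connect cl) ->; rewrite WB.
  by apply/negP => vW; have [] := satP _ _ bBC K cK v vK vW; rewrite pK.
apply/(R_mk _ _ star_balanced).
exists (fun T : {set pt3 n} => [exists t in T, t \in W]).
by split=> x; rewrite -good inE.
Qed.

End Product.
End Semantics.

(** * The inverse semigroup structure *)

Section Inverse.
Variable n : nat.
Implicit Types (a b c e : elt n) (A B C : {set 'I_n}) (v w : pt n).

Lemma glue_surj (W : {set pt n}) : exists A B, W = glue A B.
Proof.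
exists [set x | inl x \in W], [set y | inr y \in W].
by apply/setP => -[x|y]; rewrite !inE.
Qed.

(** Blocks are recovered from the unions of lines alone: a vertex is on a line iff some such union
    contains it, and its line is then the intersection of all unions through it. *)
Lemma cblk_sat (L : eqType) (f g : 'I_n -> option L) v : balanced f g ->
  cblk (both f g) v = [set w | (w == v) || [exists W, sat (mk f g) W && (v \in W)] &&
     [forall W, sat (mk f g) W ==> (v \in W) ==> (w \in W)]].
Proof.
move=> bal; apply/setP => w; rewrite !inE; congr (_ || _).
(* The line through [v], or the empty set if [v] is a point. *)
pose W0 := [set u | (both f g u != None) && (both f g u == both f g v)].
have S0 : sat (mk f g) W0.
  apply/(sat_mk _ bal); exists (fun l => both f g v == Some l) => u; rewrite inE.
  by case: (both f g u) => [l|] //=; rewrite eq_sym.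
apply/andP/andP => -[].
  move=> nv /eqP ew; split.
    by apply/existsP; exists W0; rewrite S0 inE nv eqxx.
  apply/forallP => W; apply/implyP => /(sat_mk _ bal)[S HS]; apply/implyP.
  by rewrite !HS ew.
move=> /existsP[W /andP[/(sat_mk _ bal)[S HS] vW]] /forallP/(_ _)/implyP/(_ S0).
have nv : both f g v != None by move: vW; rewrite HS; case: (both f g v).
by rewrite !inE nv eqxx /= => /andP[].
Qed.

Lemma R_inj a b : a \in PIset n -> b \in PIset n ->
  (forall A B, R a A B = R b A B) -> a = b.
Proof.
move=> /PI_mk[f [g [fg ->]]] /PI_mk[f' [g' [fg' ->]]] H.
have E W : sat (mk f g) W = sat (mk f' g') W.
  by have [A [B ->]] := glue_surj W; apply: H.
apply: eq_imset => v; rewrite !cblk_sat //; apply/setP => w; rewrite !inE.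
congr (_ || _ && _); first by apply: eq_existsb => W; rewrite E.
by apply: eq_forallb => W; rewrite E.
Qed.

(** By balance the same colours are in use on both sides, so each inclusion says that the used
    colours of [S] belong to [S']. Injectivity of [R a] in both directions follows. *)
Lemma R_sub a A B A' B' : a \in PIset n -> R a A B -> R a A' B' ->
  (A \subset A') = (B \subset B').
Proof.
move=> /PI_mk[f [g [bal ->]]] /(R_mk _ _ bal)[S [SA SB]] /(R_mk _ _ bal)[S' [SA' SB']].
have [fg gf] := bal.
apply/subsetP/subsetP => sub x; [rewrite SB SB'|rewrite SA SA'].
  case E : (g x) => [l|//]; have [y Ey] := gf _ _ E.
  by have := sub y; rewrite SA SA' Ey.
case E : (f x) => [l|//]; have [y Ey] := fg _ _ E.
by have := sub y; rewrite SB SB' Ey.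
Qed.

Lemma R_fun a A B B' : a \in PIset n -> R a A B -> R a A B' -> B = B'.
Proof.
move=> aP h h'; apply/eqP; rewrite eqEsubset.
by rewrite -(R_sub aP h h') -(R_sub aP h' h) subxx.
Qed.

Lemma R_cofun a A A' B : a \in PIset n -> R a A B -> R a A' B -> A = A'.
Proof.
move=> aP h h'; apply/eqP; rewrite eqEsubset.
by rewrite (R_sub aP h h') (R_sub aP h' h) subxx.
Qed.

Lemma R_conv a : a \in PIset n ->
  exists2 b, b \in PIset n & forall A B, R b A B = R a B A.
Proof.
move=> /PI_mk[f [g [bal ->]]]; have bal' : balanced g f by case: bal.
exists (mk g f); first exact: mk_PI.
move=> A B; apply/idP/idP => [/(R_mk _ _ bal')|/(R_mk _ _ bal)] [S [h1 h2]];
  by [apply/(R_mk _ _ bal); exists S|apply/(R_mk _ _ bal'); exists S].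
Qed.

Definition D a : {set {set 'I_n}} := [set A | [exists B, R a A B]].
Definition D' a : {set {set 'I_n}} := [set B | [exists A, R a A B]].

Lemma DP a A : reflect (exists B, R a A B) (A \in D a).
Proof. by rewrite inE; apply: existsP. Qed.

Lemma D'P a B : reflect (exists A, R a A B) (B \in D' a).
Proof. by rewrite inE; apply: existsP. Qed.

Lemma card_D' a : a \in PIset n -> #|D' a| = #|D a|.
Proof.
move=> aP; pose F A := odflt set0 [pick B | R a A B].
have FP A : A \in D a -> R a A (F A).
  by case/DP => B h; rewrite /F; case: pickP => [//|/(_ B)]; rewrite h.
have <- : F @: D a = D' a.
  apply/setP => B; apply/imsetP/D'P => [[A /FP h ->]|[A h]]; first by exists A.
  have AD : A \in D a by apply/DP; exists B.
  by exists A => //; apply: R_fun aP h (FP _ AD).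
apply: card_in_imset => A A' /FP h /FP h' e; rewrite e in h; exact: R_cofun aP h h'.
Qed.

(** Sets of lines correspond to members of [D a] through their trace on X; the trace determines the
    set because every line meets X. *)
Lemma card_D a : a \in PIset n -> #|D a| = 2 ^ rank a.
Proof.
move=> aP; have := aP; rewrite inE => /andP[pa /forall_inP la].
have tr := partition_trivIset pa.
rewrite /rank -card_powerset.
pose F (P : elt n) := [set x | inl x \in cover P].
have -> : D a = F @: powerset [set K in a | isLine K].
  apply/setP => A; apply/DP/imsetP => [[B /satP h]|[P]].
    exists [set K in a | isLine K && (K \subset glue A B)].
      by rewrite inE; apply/subsetP => K; rewrite !inE => /and3P[-> ->].
    apply/setP => x; rewrite inE; apply/idP/bigcupP => [xA|[K]].
      have [K Ka [xK _]] := PI_block (inl x) aP.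
      exists K => //; rewrite inE Ka /=.
      have [|np ->] := h K Ka _ xK; first by rewrite inE.
      by move: (la K Ka); rewrite (negbTE np) /= => ->.
    by rewrite inE => /and3P[_ _ /subsetP s] /s; rewrite inE.
  rewrite inE => /subsetP sP ->; exists [set y | inr y \in cover P].
  apply/satP => K Ka v vK.
  have -> : (v \in glue (F P) [set y | inr y \in cover P]) = (v \in cover P).
    by case: v {vK} => w; rewrite !inE.
  case/bigcupP => M MP vM; have := sP _ MP; rewrite inE => /andP[Ma Ml].
  have eKM : K = M by rewrite -(def_pblock tr Ka vK) (def_pblock tr Ma vM).
  rewrite eKM; split.
    apply/negP => /cards1P[z ez]; case/andP: Ml => /existsP[x] + /existsP[y].
    by rewrite ez !inE => /eqP<- /eqP.
  apply/subsetP => u uM; have uc : u \in cover P by apply/bigcupP; exists M.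
  by case: u uc {uM} => u uc; rewrite !inE.
apply: card_in_imset => P P'; rewrite !inE.
have sub (Q Q' : elt n) : Q \subset [set K in a | isLine K] -> Q' \subset [set K in a | isLine K] ->
    F Q = F Q' -> Q \subset Q'.
  move=> /subsetP h /subsetP h' e; apply/subsetP => K KQ.
  have := h _ KQ; rewrite inE => /andP[Ka /andP[/existsP[x xK] _]].
  have : x \in F Q by rewrite inE; apply/bigcupP; exists K.
  rewrite e inE => /bigcupP[M MQ xM]; have := h' _ MQ; rewrite inE => /andP[Ma _].
  by rewrite -(def_pblock tr Ka xK) (def_pblock tr Ma xM).
by move=> h h' e; apply/eqP; rewrite eqEsubset; apply/andP; split; apply: sub.
Qed.

Lemma star_assoc a b c : a \in PIset n -> b \in PIset n -> c \in PIset n ->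
  star a (star b c) = star (star a b) c.
Proof.
move=> aP bP cP; have abP := star_PI aP bP; have bcP := star_PI bP cP.
apply: R_inj; rewrite ?star_PI // => A B; apply/idP/idP.
  case/(R_star aP bcP) => C [h /(R_star bP cP)[C' [h1 h2]]].
  by apply/(R_star abP cP); exists C'; split=> //; apply/(R_star aP bP); exists C.
case/(R_star abP cP) => C [/(R_star aP bP)[C' [h1 h2]] h].
by apply/(R_star aP bcP); exists C'; split=> //; apply/(R_star bP cP); exists C.
Qed.

Lemma pw_PI a k : a \in PIset n -> pw a k \in PIset n.
Proof. by move=> aP; elim: k => //= k IH; apply: star_PI. Qed.

Lemma star_pw a i j : a \in PIset n -> star (pw a i) (pw a j) = pw a (i + j).+1.
Proof.
move=> aP; elim: i => [|i IH]; first by [].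
by rewrite [pw a i.+1]/= -(star_assoc aP (pw_PI i aP) (pw_PI j aP)) IH.
Qed.

Lemma pwSr a k : a \in PIset n -> pw a k.+1 = star (pw a k) a.
Proof. by move=> aP; rewrite -[in RHS](erefl : pw a 0 = a) star_pw // addn0. Qed.

Lemma pw_idem a : a \in PIset n -> exists k, idem (pw a k).
Proof.
move=> aP.
have [i [p ep]] : exists i p, pw a i = pw a (i + p.+1).
  have : ~~ injectiveb (fun k : 'I_#|elt n|.+1 => pw a k).
    apply/negP => /injectiveP/leq_card; rewrite card_ord ltnn //.
  case/injectivePn => x [y nxy e]; wlog xy : x y nxy e / x < y.
    move=> W; case: (ltngtP x y) => [|lt|/val_inj exy].
    - exact: W.
    - by apply: (W y x); rewrite // eq_sym.
    - by rewrite exy eqxx in nxy.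
  by exists x, (y - x).-1; rewrite e; congr pw; rewrite prednK ?subn_gt0 // subnKC // ltnW.
have per1 m : i <= m -> pw a (m + p.+1) = pw a m.
  rewrite leq_eqVlt => /predU1P[<-//|lt].
  have -> : m = (i + (m - i.+1)).+1 by rewrite -addSn subnKC.
  by rewrite -star_pw // ep star_pw //; congr pw; rewrite !addSn addnAC.
have per m j : i <= m -> pw a (m + j * p.+1) = pw a m.
  move=> im; elim: j => [|j IH]; first by rewrite addn0.
  by rewrite mulSn addnCA addnC per1 ?IH // (leq_trans im) ?leq_addr.
(* As [pw a k] is the power with exponent [k.+1], the exponent here is [i.+1 * p.+1]: a multiple of
   the period, beyond the preperiod. *)
exists (i.+1 * p.+1).-1; rewrite /idem star_pw //.
have k0 : 0 < i.+1 * p.+1 by rewrite muln_gt0.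
rewrite -addnS prednK // per // -ltnS prednK //.
by rewrite leq_pmulr.
Qed.

(** If [e] sends [A] to [B], idempotency forces it to fix [B], and injectivity gives [A = B]. *)
Lemma idem_R e A B : e \in PIset n -> idem e -> R e A B = (A == B) && (A \in D e).
Proof.
move=> eP /eqP ee; apply/idP/andP => [h|[/eqP<- /DP[C h]]].
  split; last by apply/DP; exists B.
  have := h; rewrite -{1}ee => /(R_star eP eP)[C [h1 h2]].
  have eC := R_fun eP h h1; subst C.
  by apply/eqP; rewrite (R_cofun eP h h2).
have := h; rewrite -{1}ee => /(R_star eP eP)[C' [h1 h2]].
have eC := R_fun eP h h1; subst C'.
by have eA := R_cofun eP h h2; rewrite -eA in h.
Qed.

Lemma idemP e : e \in PIset n -> (forall A B, R e A B -> A = B) -> idem e.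
Proof.
move=> eP h; apply/eqP/R_inj; rewrite ?star_PI // => A B.
apply/idP/idP => [/(R_star eP eP)[C [h1 h2]]|h1]; first by rewrite (h _ _ h1).
by apply/(R_star eP eP); exists B; split=> //; rewrite -{1}(h _ _ h1).
Qed.

Lemma idem_D' e : e \in PIset n -> idem e -> D' e = D e.
Proof.
move=> eP ie; apply/setP => A; apply/D'P/DP => -[B]; rewrite idem_R // => /andP[/eqP e1 h];
  by subst B; exists A; rewrite idem_R // eqxx.
Qed.

Lemma idem_D_inj e f : e \in PIset n -> idem e -> f \in PIset n -> idem f ->
  D e = D f -> e = f.
Proof. by move=> eP ie fP jf h; apply: R_inj => // A B; rewrite !idem_R // h. Qed.

Lemma idem_star e f : e \in PIset n -> idem e -> f \in PIset n -> idem f ->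
  idem (star e f) /\ D (star e f) = D e :&: D f.
Proof.
move=> eP ie fP jf.
have H A B : R (star e f) A B <-> A = B /\ A \in D e /\ A \in D f.
  split=> [/(R_star eP fP)[C]|[<- [h1 h2]]].
    by rewrite !idem_R // => -[/andP[/eqP<- h] /andP[/eqP<- h']].
  by apply/(R_star eP fP); exists A; rewrite !idem_R // eqxx.
split; first by apply: idemP; rewrite ?star_PI // => A B /H[].
apply/setP => A; rewrite in_setI; apply/DP/andP => [[B /H[_ [h h']]]//|[h h']].
by exists A; apply/H.
Qed.

(** * Idempotents as equivalences with an adjoined zero *)

Section Diag.
Variable L : eqType.
Implicit Types (f g : 'I_n -> option L).

Definition diag f := mk f f.

Lemma balanced_refl f : balanced f f.
Proof. by split=> x l h; exists x. Qed.

Lemma diag_PI f : diag f \in PIset n.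
Proof. exact/mk_PI/balanced_refl. Qed.

Lemma mem_D_mk f g A : balanced f g ->
  reflect (exists S : pred L, forall x, (x \in A) = oapp S false (f x)) (A \in D (mk f g)).
Proof.
move=> bal; apply: (iffP (DP _ _)) => [[B /(R_mk _ _ bal)[S [h _]]]|[S h]].
  by exists S.
exists [set y | oapp S false (g y)]; apply/(R_mk _ _ bal); exists S.
by split=> // y; rewrite inE.
Qed.

Lemma diag_idem f : idem (diag f).
Proof.
apply: idemP; first exact: diag_PI.
move=> A B /(R_mk _ _ (balanced_refl f))[S [h1 h2]].
by apply/setP => x; rewrite h1 h2.
Qed.

(* [None : option 'I_n] plays the role of the adjoined zero, glued to exactly the points of [diag f]. *)
Definition ext f (z : option 'I_n) : option L := obind f z.
Definition xin A (z : option 'I_n) : bool := oapp (mem A) false z.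

(** With the zero counted outside every set, the domain consists of the sets saturated for the
    equivalence; points are excluded since they are equivalent to the zero. *)
Lemma mem_D_diag f A :
  reflect (forall y z, ext f y = ext f z -> xin A y = xin A z) (A \in D (diag f)).
Proof.
apply: (iffP (mem_D_mk _ (balanced_refl f))) => [[S h] y z|h].
  have E u : xin A u = oapp S false (ext f u) by case: u => [x|] //=; rewrite -h.
  by rewrite !E => ->.
exists (fun l => [exists y in A, f y == Some l]) => x.
case E : (f x) => [l|] /=; last exact: (h (Some x) None).
apply/idP/exists_inP => [xA|[y yA /eqP e]]; first by exists x; rewrite ?E.
by rewrite -[_ \in _]/(xin A (Some x)) (h (Some x) (Some y)) //= E e.
Qed.

Lemma class_D f y : f y != None -> [set x | f x == f y] \in D (diag f).
Proof.
move=> ny; apply/mem_D_diag => z1 z2.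
have E u : xin [set x | f x == f y] u = (ext f u == f y).
  by case: u => [x|] /=; [rewrite inE | rewrite eq_sym (negbTE ny)].
by rewrite !E => ->.
Qed.

End Diag.

(** The domain of [mk f g] depends on [f] alone, and idempotents with equal domains coincide. *)
Lemma idem_diag e : e \in PIset n -> idem e ->
  exists f : 'I_n -> option {set pt n}, e = diag f.
Proof.
move=> eP ie; have [f [g [bal ee]]] := PI_mk eP; exists f.
apply: idem_D_inj; rewrite ?diag_PI ?diag_idem //.
apply/setP => A; rewrite ee; apply/mem_D_mk/mem_D_mk => //; exact: balanced_refl.
Qed.

End Inverse.

(** * The listed subsemigroups are isolated *)

Section Listed.
Variable n : nat.
Implicit Types (a b c e : elt n) (A B C U V Z : {set 'I_n}) (v w : pt n).

Lemma D_star a b : a \in PIset n -> b \in PIset n -> D (star a b) \subset D a.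
Proof.
move=> aP bP; apply/subsetP => A /DP[B /(R_star aP bP)[C [h _]]].
by apply/DP; exists C.
Qed.

Lemma D'_star a b : a \in PIset n -> b \in PIset n -> D' (star a b) \subset D' b.
Proof.
move=> aP bP; apply/subsetP => A /D'P[B /(R_star aP bP)[C [_ h]]].
by apply/D'P; exists C.
Qed.

Lemma D_pw a k : a \in PIset n -> D (pw a k) \subset D a.
Proof. by move=> aP; case: k => //= k; apply: D_star => //; apply: pw_PI. Qed.

Lemma D'_pw a k : a \in PIset n -> D' (pw a k) \subset D' a.
Proof.
move=> aP; case: k => [//|k]; rewrite pwSr //; apply: D'_star => //; exact: pw_PI.
Qed.

(* [IZ Z] and [SZ Z] with Z = X or Z = X minus t are the two families of the theorem. *)
Definition IZ Z : {set elt n} := [set a in PIset n | R a Z Z & D a \subset powerset Z].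
Definition SZ Z : {set elt n} :=
  [set a in PIset n | (D a == powerset Z) && (D' a == powerset Z)].

Lemma IZP Z a : reflect [/\ a \in PIset n, R a Z Z & D a \subset powerset Z] (a \in IZ Z).
Proof. by rewrite [_ \in IZ Z]in_set; apply: and3P. Qed.

Lemma SZP Z a : reflect [/\ a \in PIset n, D a = powerset Z & D' a = powerset Z] (a \in SZ Z).
Proof. by rewrite [_ \in SZ Z]in_set; apply: (iffP and3P) => -[h /eqP h1 /eqP h2]; split=> //; apply/eqP. Qed.

Lemma IZ_PI Z a : a \in IZ Z -> a \in PIset n.
Proof. by case/IZP. Qed.

Lemma IZ_D' Z a : a \in IZ Z -> D' a \subset powerset Z.
Proof.
case/IZP => aP aZ /subsetP sD; apply/subsetP => B /D'P[A h].
by rewrite powersetE -(R_sub aP h aZ) -powersetE sD //; apply/DP; exists B.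
Qed.

Lemma R_top a : a \in PIset n ->
  exists U V, R a U V /\ forall A B, R a A B -> A \subset U /\ B \subset V.
Proof.
case/PI_mk => f [g [bal ->]].
exists [set x | f x], [set y | g y]; split.
  by apply/(R_mk _ _ bal); exists predT; split=> x; rewrite inE; [case: (f x)|case: (g x)].
move=> A B /(R_mk _ _ bal)[S [h1 h2]]; split; apply/subsetP => x; rewrite ?h1 ?h2 inE.
  by case: (f x).
by case: (g x).
Qed.

(** [R a] preserves inclusions, so once the first step of the orbit of [A] goes up, all later ones
    do. The next lemma is the dual. *)
Lemma pw_increasing a k A B C : a \in PIset n -> R a A B -> A \subset B ->
  R (pw a k) A C -> B \subset C.
Proof.
move=> aP; elim: k A B => [|k IH] A B h sAB.
  by move/(R_fun aP h) => <-.
case/(R_star aP (pw_PI k aP)) => B' [/(R_fun aP h) <- hk].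
have /DP[B2 h2] : B \in D a by apply: (subsetP (D_pw k aP)); apply/DP; exists C.
have sB : B \subset B2 by rewrite -(R_sub aP h h2).
exact: subset_trans sB (IH _ _ h2 sB hk).
Qed.

Lemma pw_decreasing a k A B C : a \in PIset n -> R a A B -> B \subset A ->
  R (pw a k) A C -> C \subset B.
Proof.
move=> aP; elim: k A B => [|k IH] A B h sAB.
  by move/(R_fun aP h) => <-.
case/(R_star aP (pw_PI k aP)) => B' [/(R_fun aP h) <- hk].
have /DP[B2 h2] : B \in D a by apply: (subsetP (D_pw k aP)); apply/DP; exists C.
have sB : B2 \subset B by rewrite -(R_sub aP h2 h).
exact: subset_trans (IH _ _ h2 sB hk) sB.
Qed.

Lemma R_pw_fix a k A : a \in PIset n -> R a A A -> R (pw a k) A A.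
Proof.
move=> aP h; elim: k => [//|k IH]; apply/(R_star aP (pw_PI k aP)); by exists A.
Qed.

Lemma IZ_star Z a b : a \in IZ Z -> b \in IZ Z -> star a b \in IZ Z.
Proof.
move=> /IZP[aP aZ aD] /IZP[bP bZ bD]; apply/IZP; split; first exact: star_PI.
  by apply/(R_star aP bP); exists Z.
exact: subset_trans (D_star aP bP) aD.
Qed.

Lemma sup_cotrivial Z U : #|~: Z| <= 1 -> Z \subset U -> U = Z \/ U = [set: 'I_n].
Proof.
move=> cZ sZU; case: (set_0Vmem (~: U)) => [e|[x xU]].
  by right; apply/setP => x; have /setP/(_ x) := e; rewrite !inE => /negbFE.
left; apply/eqP; rewrite eqEsubset sZU andbT; apply/subsetP => y yU.
apply: contraTT (xU) => yZ; rewrite inE negbK.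
have xZ : x \in ~: Z by move: xU; rewrite !inE; apply: contra; apply: (subsetP sZU).
have yZ' : y \in ~: Z by rewrite inE.
by rewrite ((card_le1_eqP cZ) y x yZ' xZ).
Qed.

(* If [a] moved [Z], then by monotonicity the iterates of [Z] would never return to [Z]. *)
Lemma IZ_isolated Z : #|~: Z| <= 1 -> isolated (IZ Z).
Proof.
move=> cZ a aP k /IZP[_ kZ kD].
have [U [V [hUV top]]] := R_top aP.
have /DP[A1 h1] : Z \in D a by apply: (subsetP (D_pw k aP)); apply/DP; exists Z.
have /D'P[B1 h1'] : Z \in D' a by apply: (subsetP (D'_pw k aP)); apply/D'P; exists Z.
have [sZU sA1V] := top _ _ h1; have [_ sZV] := top _ _ h1'.
(* If [a] fixes the whole of X, so does its power, whose domain contains only subsets of [Z]. *)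
have TT : R a [set: 'I_n] [set: 'I_n] -> Z = [set: 'I_n].
  move=> h; apply/eqP; rewrite eqEsubset subsetT /= -powersetE (subsetP kD) //.
  by apply/DP; exists [set: 'I_n]; apply: R_pw_fix.
have eA1 : A1 = Z.
  (* Each of [U] and [V] is [Z] or X, and every combination makes the image [A1] of [Z] comparable
     with [Z]. *)
  have cmp : (A1 \subset Z) || (Z \subset A1).
    have [eV|eV] := sup_cotrivial cZ sZV; first by rewrite -{1}eV sA1V.
    have [eU|eU] := sup_cotrivial cZ sZU.
      by rewrite (R_fun aP h1 (_ : R a Z V)) -?eU // eV subsetT orbT.
    have eZ : Z = [set: 'I_n] by apply: TT; rewrite -{1}eU -eV.
    by rewrite eZ subsetT.
  apply/eqP; rewrite eqEsubset; case/orP: cmp => h; rewrite h ?andbT /=.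
    exact: pw_decreasing aP h1 h kZ.
  exact: pw_increasing aP h1 h kZ.
subst A1; apply/IZP; split=> //.
suff sUZ : U \subset Z.
  apply/subsetP => A /DP[B /top[h _]]; rewrite powersetE; exact: subset_trans h sUZ.
apply: contraT => nU.
have nV : ~~ (V \subset Z) by rewrite -(R_sub aP hUV h1).
have eU : U = [set: 'I_n].
  by case: (sup_cotrivial cZ sZU) => // e; rewrite e subxx in nU.
have eV : V = [set: 'I_n].
  by case: (sup_cotrivial cZ sZV) => // e; rewrite e subxx in nV.
by move: nU; rewrite (TT _) ?subsetT //; rewrite -{1}eU -eV.
Qed.

Lemma SZ_IZ Z a : a \in SZ Z -> a \in IZ Z.
Proof.
case/SZP => aP aD aD'; apply/IZP; rewrite aD subxx; split=> //.
have /DP[B h] : Z \in D a by rewrite aD powersetE.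
have /D'P[A h'] : Z \in D' a by rewrite aD' powersetE.
have sB : B \subset Z by rewrite -powersetE -aD'; apply/D'P; exists Z.
have sA : A \subset Z by rewrite -powersetE -aD; apply/DP; exists Z.
suff eB : Z = B by rewrite {2}eB.
by apply/eqP; rewrite eqEsubset sB andbT -(R_sub aP h' h).
Qed.

Lemma SZ_star Z a b : a \in SZ Z -> b \in SZ Z -> star a b \in SZ Z.
Proof.
move=> aS bS; have /IZP[cP _ cD] := IZ_star (SZ_IZ aS) (SZ_IZ bS).
case/SZP: (aS) => aP aD aD'; case/SZP: (bS) => bP bD bD'.
have eD : D (star a b) = powerset Z.
  apply/eqP; rewrite eqEsubset cD /= -aD; apply/subsetP => A /DP[B h].
  have /DP[C h'] : B \in D b by rewrite bD -aD'; apply/D'P; exists A.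
  by apply/DP; exists C; apply/(R_star aP bP); exists B.
apply/SZP; split=> //; apply/eqP; rewrite eqEcard card_D' // eD leqnn andbT.
exact: IZ_D' (IZ_star (SZ_IZ aS) (SZ_IZ bS)).
Qed.

Lemma SZ_isolated Z : #|~: Z| <= 1 -> isolated (SZ Z).
Proof.
move=> cZ a aP k kS; case/SZP: (kS) => kP kD kD'.
have aI := IZ_isolated cZ aP (SZ_IZ kS); case/IZP: (aI) => _ _ aD.
apply/SZP; split=> //; apply/eqP; rewrite eqEsubset ?aD ?(IZ_D' aI) /=.
  by rewrite -kD D_pw.
by rewrite -kD' D'_pw.
Qed.

Lemma SZ_of_D Z a : a \in PIset n -> D' a \subset powerset Z -> D a = powerset Z -> a \in SZ Z.
Proof.
move=> aP sD' eD; apply/SZP; split=> //.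
by apply/eqP; rewrite eqEcard sD' card_D' // eD leqnn.
Qed.

Lemma pw_closed (T : {set elt n}) a k : {in T &, forall a b, star a b \in T} ->
  a \in T -> pw a k \in T.
Proof. by move=> cl aT; elim: k => //= k IH; apply: cl. Qed.

Definition bounded Z (T : {set elt n}) := forall a, a \in T ->
  [/\ a \in PIset n, D a \subset powerset Z & D' a \subset powerset Z].

Lemma bounded_IZ Z : bounded Z (IZ Z).
Proof. by move=> a aI; case/IZP: (aI) => aP _ aD; split=> //; apply: IZ_D'. Qed.

Lemma bounded_PI : bounded [set: 'I_n] (PIset n).
Proof. by move=> a aP; split=> //; rewrite powersetT subsetT. Qed.

(** Domains shrink under right multiplication, so a product with full domain has a left factor with
    full domain, and counting makes the range of that factor full as well. *)
Lemma complement_star Z (T : {set elt n}) : bounded Z T ->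
  {in T &, forall a b, star a b \in T} ->
  {in T :\: SZ Z &, forall a b, star a b \in T :\: SZ Z}.
Proof.
move=> sT cl a b /setDP[aT naS] /setDP[bT _].
apply/setDP; split; first exact: cl.
apply: contra naS => /SZP[_ eD _].
have [aP aD aD'] := sT _ aT; have [bP _ _] := sT _ bT.
apply: SZ_of_D => //; apply/eqP; rewrite eqEsubset aD /= -eD.
exact: D_star.
Qed.

Lemma complement_isolated Z (T : {set elt n}) : bounded Z T ->
  isolated T -> isolated (T :\: SZ Z).
Proof.
move=> sT iso a aP k /setDP[kT kS]; apply/setDP; split; first exact: iso kT.
apply: contra kS; apply: pw_closed => x y; exact: SZ_star.
Qed.

(** Being H-related to [e] means having the same domain and range as [e]. The multipliers are [a]
    itself and its converse [b], for which [star a b] and [star b a] both equal [e]. *)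
Lemma GclP e a : e \in PIset n -> idem e ->
  reflect [/\ a \in PIset n, D a = D e & D' a = D e] (a \in Gcl e).
Proof.
move=> eP ie; rewrite [_ \in Gcl e]in_set /Hrel.
have PI1 b c : b \in PIset n -> c \in PIset n -> inRideal b c -> D b \subset D c.
  move=> bP cP /orP[/eqP->//|/exists_inP[x xP /eqP->]]; exact: D_star.
have PI2 b c : b \in PIset n -> c \in PIset n -> inLideal b c -> D' b \subset D' c.
  move=> bP cP /orP[/eqP->//|/exists_inP[x xP /eqP->]]; exact: D'_star.
apply: (iffP andP) => [[aP /and4P[h1 h2 h3 h4]]|[aP eD eD']].
  split=> //; apply/eqP; rewrite eqEsubset; first by rewrite !PI1.
  by rewrite -(idem_D' eP ie) !PI2.
split=> //; have [b bP bR] := R_conv aP.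
have inD A B : R a A B -> A \in D e by move=> h; rewrite -eD; apply/DP; exists B.
have inD' A B : R a A B -> B \in D e by move=> h; rewrite -eD'; apply/D'P; exists A.
apply/and4P; split; apply/orP; right; apply/exists_inP.
- exists a => //; apply/eqP/R_inj; rewrite ?star_PI // => A B.
  apply/idP/(R_star eP aP) => [h|[C]].
    by exists A; rewrite idem_R // eqxx (inD _ _ h).
  by rewrite idem_R // => -[/andP[/eqP->]].
- exists b => //; apply/eqP/R_inj; rewrite ?star_PI // => A B.
  rewrite idem_R //; apply/idP/(R_star aP bP) => [/andP[/eqP<-]|[C []]].
    by rewrite -eD => /DP[C h]; exists C; rewrite bR.
  by rewrite bR => h h'; rewrite (R_cofun aP h h') eqxx (inD _ _ h').
- exists a => //; apply/eqP/R_inj; rewrite ?star_PI // => A B.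
  apply/idP/(R_star aP eP) => [h|[C [h]]].
    by exists B; rewrite (idem_R _ _ eP ie) eqxx (inD' _ _ h).
  by rewrite idem_R // => /andP[/eqP<-].
- exists b => //; apply/eqP/R_inj; rewrite ?star_PI // => A B.
  rewrite idem_R //; apply/idP/(R_star bP aP) => [/andP[/eqP<-]|[C []]].
    by rewrite -eD' => /D'P[C h]; exists C; rewrite bR.
  by rewrite bR => h h'; rewrite (R_fun aP h h') eqxx (inD' _ _ h').
Qed.

Lemma Gcl_id e : e \in PIset n -> idem e -> e \in Gcl e.
Proof. by move=> eP ie; apply/GclP => //; rewrite idem_D'. Qed.

Lemma Gcl_star e : e \in PIset n -> idem e -> {in Gcl e &, forall a b, star a b \in Gcl e}.
Proof.
move=> eP ie a b /(GclP _ eP ie)[aP aD aD'] /(GclP _ eP ie)[bP bD bD'].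
apply/(GclP _ eP ie); split; first exact: star_PI.
  apply/eqP; rewrite eqEsubset -{1}aD D_star //=; apply/subsetP => A.
  rewrite -aD => /DP[B h]; have /DP[C h'] : B \in D b by rewrite bD -aD'; apply/D'P; exists A.
  by apply/DP; exists C; apply/(R_star aP bP); exists B.
apply/eqP; rewrite eqEsubset -{1}bD' D'_star //=; apply/subsetP => C.
rewrite -bD' => /D'P[B h]; have /D'P[A h'] : B \in D' a by rewrite aD' -bD; apply/DP; exists C.
by apply/D'P; exists A; apply/(R_star aP bP); exists B.
Qed.

(** A root [a] of an element of the group lies in [IZ Z], and its domain and range contain [D e].
    Full domain would put all powers of [a] in [SZ Z], against the rank of [e]; so [a] has rank
    exactly one below [#|Z|], and the inclusions are equalities. *)
Lemma Gcl_isolated Z e : #|~: Z| <= 1 -> 0 < #|Z| -> e \in IZ Z -> idem e ->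
  rank e = #|Z|.-1 -> isolated (Gcl e).
Proof.
move=> cZ Z0 eI ie re a aP k /(GclP _ (IZ_PI eI) ie)[kP kD kD'].
have eP := IZ_PI eI; case/IZP: (eI) => _ eZ eD.
have kI : pw a k \in IZ Z.
  apply/IZP; split=> //; last by rewrite kD.
  have /DP[B h] : Z \in D (pw a k) by rewrite kD; apply/DP; exists Z.
  have /D'P[A h'] : Z \in D' (pw a k) by rewrite kD'; apply/DP; exists Z.
  have sB : B \subset Z.
    by rewrite -powersetE (subsetP eD) // -kD'; apply/D'P; exists Z.
  have sA : A \subset Z.
    by rewrite -powersetE (subsetP eD) // -kD; apply/DP; exists Z.
  suff eB : Z = B by rewrite {2}eB.
  by apply/eqP; rewrite eqEsubset sB andbT -(R_sub kP h' h).
have aI := IZ_isolated cZ aP kI; case/IZP: (aI) => _ _ aD.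
have s1 : D e \subset D a by rewrite -kD D_pw.
have s2 : D e \subset D' a by rewrite -kD' D'_pw.
have aZ : D a <> powerset Z.
  move=> h; have aS := SZ_of_D aP (IZ_D' aI) h.
  have /SZP[_ h' _] : pw a k \in SZ Z by apply: pw_closed aS => x y; apply: SZ_star.
  have := card_D eP; rewrite -kD h' card_powerset re => /eqP.
  by rewrite eqn_exp2l // -{1}(prednK Z0) eqn_leq ltnn.
have ra : rank a = rank e.
  have l1 : rank e <= rank a.
    by rewrite -(leq_exp2l (m := 2)) // -!card_D // subset_leq_card.
  have l2 : rank a < #|Z|.
    rewrite -(ltn_exp2l (m := 2)) // -card_D // -card_powerset proper_card //.
    by rewrite properEneq aD andbT; apply/eqP.
  by apply/eqP; rewrite eqn_leq l1 andbT re -ltnS prednK.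
apply/(GclP _ eP ie); split=> //; apply/esym/eqP; rewrite eqEcard.
  by rewrite s1 !card_D // ra leqnn.
by rewrite s2 card_D' // !card_D // ra leqnn.
Qed.

Lemma isPoint1 v : isPoint [set v].
Proof. by rewrite /isPoint cards1. Qed.

Lemma glueTT : glue [set: 'I_n] [set: 'I_n] = [set: pt n].
Proof. by apply/setP => -[x|x]; rewrite !inE. Qed.

Lemma PI_uniq_block a K (M : {set pt n}) v : a \in PIset n ->
  K \in a -> M \in a -> v \in K -> v \in M -> K = M.
Proof.
rewrite inE => /andP[/partition_trivIset tr _] Ka Ma vK vM.
by rewrite -(def_pblock tr Ka vK) (def_pblock tr Ma vM).
Qed.

Lemma Iset_IZ : Iset n = IZ [set: 'I_n].
Proof.
apply/setP => a; rewrite [_ \in Iset n]in_set; apply/andP/IZP.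
  move=> [aP /forall_inP h]; split=> //; last by rewrite powersetT subsetT.
  by apply/satP => K Ka v vK _; rewrite glueTT subsetT h.
case=> aP /satP h _; split=> //; apply/forall_inP => K Ka.
apply/negP => pK; have /cards1P[v eK] := pK.
have vK : v \in K by rewrite eK inE.
have vT : v \in glue [set: 'I_n] [set: 'I_n] by rewrite glueTT inE.
by have [] := h K Ka v vK vT; rewrite pK.
Qed.

Lemma in_glueC t (A := [set~ t]) v : (v \in glue A A) = (v != inl t) && (v != inr t).
Proof. by case: v => x; rewrite !inE ?andbT. Qed.

Lemma IYset_IZ t : IYset t = IZ [set~ t].
Proof.
apply/setP => a; rewrite [_ \in IYset t]in_set; apply/andP/IZP.
  move=> [aP /eqP /setP h].
  have hpt K : (K \in a) && isPoint K = (K == [set inl t]) || (K == [set inr t]).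
    by have := h K; rewrite !inE.
  have /andP[lt plt] : ([set inl t] \in a) && isPoint [set inl t : pt n].
    by rewrite hpt eqxx.
  have /andP[rt prt] : ([set inr t] \in a) && isPoint [set inr t : pt n].
    by rewrite hpt eqxx orbT.
  split=> //.
    apply/satP => K Ka v vK; rewrite in_glueC => /andP[n1 n2].
    have nK : ~~ isPoint K.
      apply/negP => pK; have := hpt K; rewrite Ka pK => /esym/orP[]/eqP eK;
      by move: vK n1 n2; rewrite eK inE => /eqP->; rewrite eqxx.
    split=> //; apply/subsetP => w wK; rewrite in_glueC.
    apply/andP; split; apply: contraNneq nK => ew; subst w.
      by rewrite (PI_uniq_block aP Ka lt wK) ?inE.
    by rewrite (PI_uniq_block aP Ka rt wK) ?inE.
  apply/subsetP => A /DP[B /satP hs]; rewrite powersetE; apply/subsetP => x xA.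
  rewrite !inE; apply/negP => /eqP ex; subst x.
  have tK : inl t \in glue A B by rewrite inE.
  by have [] := hs _ lt (inl t) (set11 _) tK; rewrite isPoint1.
case=> aP aR aD; have /satP h := aR; split=> //.

(* A line through [t] or [t'] would be a pair in [R a] by itself; but the domain avoids [t], and
   comparison with the fixed set [[set~ t]] shows that the range does too. *)
have key K v : K \in a -> v \in K -> v = inl t \/ v = inr t -> K = [set v].
  move=> Ka vK ev; have [M Ma [vM cM]] := PI_block v aP.
  have eM := PI_uniq_block aP Ka Ma vK vM; subst M.
  case: cM => [/cards1P[z ez]|[[x xK] [y yK]]].
    by move: vK; rewrite ez inE => /eqP->.
  have RK : R a [set z | inl z \in K] [set z | inr z \in K].
    apply/satP => M Ma' w wM wK.
    have wK' : w \in K by case: w wK {wM} => w; rewrite !inE.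
    have eM := PI_uniq_block aP Ma' Ka wM wK'; subst M; split.
      by apply/negP => /cards1P[z ez]; move: xK yK; rewrite ez !inE => /eqP<- /eqP.
    by apply/subsetP => -[z|z] zK; rewrite !inE.
  have s1 : [set z | inl z \in K] \subset [set~ t].
    by rewrite -powersetE (subsetP aD) //; apply/DP; exists [set z | inr z \in K].
  have s2 : [set z | inr z \in K] \subset [set~ t] by rewrite -(R_sub aP RK aR).
  case: ev => ev; subst v.
    by have := subsetP s1 t; rewrite !inE vK eqxx => /(_ isT).
  by have := subsetP s2 t; rewrite !inE vK eqxx => /(_ isT).
apply/eqP/setP => K; rewrite !inE; apply/andP/orP.
  move=> [Ka pK]; have /cards1P[v eK] := pK; subst K.
  have : v \notin glue [set~ t] [set~ t].
    by apply/negP => vg; have [] := h _ Ka v (set11 v) vg; rewrite pK.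
  by rewrite in_glueC negb_and !negbK => /orP[]/eqP->; [left|right].
move=> eK; have [v ev eK'] : exists2 v, v = inl t \/ v = inr t & K = [set v].
  by case: eK => /eqP->; [exists (inl t)|exists (inr t)]; auto.
rewrite eK' isPoint1; split=> //.
have [M Ma [vM _]] := PI_block v aP.
by rewrite -(key M v Ma vM ev).
Qed.

End Listed.

(** * Permutations of the support *)

Section Units.
Variable n : nat.
Implicit Types (a b c e : elt n) (A B C U V Z : {set 'I_n}) (v w : pt n) (p : {perm 'I_n}).

Lemma cpart_eq (L L' : eqType) (phi : pt n -> option L) (psi : pt n -> option L') :
  (forall v, (phi v != None) = (psi v != None)) ->
  (forall v w, phi v != None -> (phi w == phi v) = (psi w == psi v)) ->
  cpart phi = cpart psi.
Proof.
move=> h1 h2; apply: eq_imset => v; apply/setP => w; rewrite !inE; congr (_ || _).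
by rewrite -h1; case nv : (phi v != None) => //=; apply: h2.
Qed.

Definition on (L : Type) Z (f : 'I_n -> L) x : option L := if x \in Z then Some (f x) else None.

Definition stable p Z := forall x, (p x \in Z) = (x \in Z).

Lemma stable_perm_of_inj (h : 'I_n -> 'I_n) Z (hi : injective h) :
  (forall x, (h x \in Z) = (x \in Z)) -> stable (perm hi) Z.
Proof. by move=> st x; rewrite permE. Qed.

(** A vertex of X in [Z] is coloured by its image under [p] and one of X' by itself, which yields
    the lines {x, p(x)'}; everything outside [Z] is a point. *)
Definition pmk p Z : elt n := mk (on Z p) (on Z id).

Lemma pmk_balanced p Z : stable p Z -> balanced (on Z p) (on Z id).
Proof.
move=> st; split=> x l; rewrite /on; case: ifP => // xZ [<-].
  by exists (p x); rewrite st xZ.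
by exists ((p^-1)%g x); rewrite -st permKV xZ.
Qed.

Lemma pmk_SZ p Z : stable p Z -> pmk p Z \in SZ Z.
Proof.
move=> st; have bal := pmk_balanced st; have aP := mk_PI bal.
apply: SZ_of_D => //.
  apply/subsetP => B /D'P[A /(R_mk _ _ bal)[S [_ h]]]; rewrite powersetE.
  by apply/subsetP => x; rewrite h /on; case: ifP.
apply/setP => A; rewrite powersetE; apply/(mem_D_mk _ bal)/subsetP => [[S h] x|sA].
  by rewrite h /on; case: ifP.
exists (fun l => (p^-1)%g l \in A) => x; rewrite /on; case: ifP => /= xZ.
  by rewrite permK.
by apply/negP => /sA; rewrite xZ.
Qed.

(** Singletons of [Z] belong to the domain and to the range, so both colourings are injective on
    [Z]; matching equal colours defines the permutation. *)
Lemma SZ_pmk Z a : a \in SZ Z -> exists2 p, stable p Z & a = pmk p Z.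
Proof.
case/SZP => aP; have [f [g [bal ->]]] := PI_mk aP => eD eD'.
have [fg gf] := bal.
have bal' : balanced g f by split.
have fZ x : (f x != None) = (x \in Z).
  have m1 : [set y | f y != None] \in D (mk f g).
    by apply/(mem_D_mk _ bal); exists predT => y; rewrite inE; case: (f y).
  apply/idP/idP => [nx|xZ].
    by move: m1; rewrite eD powersetE => /subsetP; apply; rewrite inE.
  have : Z \in D (mk f g) by rewrite eD powersetE.
  by case/(mem_D_mk _ bal) => S /(_ x); rewrite xZ; case: (f x).
have D'E B : (B \in D' (mk f g)) = (B \in D (mk g f)).
  by apply/D'P/DP => -[A] => [/(R_mk _ _ bal)|/(R_mk _ _ bal')] [S [h1 h2]];
     exists A; [apply/(R_mk _ _ bal')|apply/(R_mk _ _ bal)]; exists S.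
have gZ x : (g x != None) = (x \in Z).
  have m1 : [set y | g y != None] \in D' (mk f g).
    by rewrite D'E; apply/(mem_D_mk _ bal'); exists predT => y; rewrite inE; case: (g y).
  apply/idP/idP => [nx|xZ].
    by move: m1; rewrite eD' powersetE => /subsetP; apply; rewrite inE.
  have : Z \in D' (mk f g) by rewrite eD' powersetE.
  by rewrite D'E; case/(mem_D_mk _ bal') => S /(_ x); rewrite xZ; case: (g x).
have fI x y : x \in Z -> f x = f y -> x = y.
  move=> xZ e; have : [set x] \in D (mk f g) by rewrite eD powersetE sub1set.
  by case/(mem_D_mk _ bal) => S h; have := h y; rewrite -e -h !inE eqxx => /eqP.
have gI x y : x \in Z -> g x = g y -> x = y.
  move=> xZ e; have : [set x] \in D' (mk f g) by rewrite eD' powersetE sub1set.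
  by rewrite D'E; case/(mem_D_mk _ bal') => S h; have := h y; rewrite -e -h !inE eqxx => /eqP.
(* The map is extended by the identity outside [Z]; inside [Z] balance supplies a match, so the
   default of [odflt] is never taken. *)
pose h x := if x \in Z then odflt x [pick y | g y == f x] else x.
have hP x : x \in Z -> g (h x) = f x.
  move=> xZ; rewrite /h xZ; case: pickP => [y /eqP->//|no].
  move: xZ; rewrite -fZ; case E : (f x) => [l|//] _; have [y ey] := fg _ _ E.
  by have := no y; rewrite ey E eqxx.
have hZ x : (h x \in Z) = (x \in Z).
  case xZ : (x \in Z); last by rewrite /h xZ.
  by rewrite -gZ hP // fZ.
have hI : injective h.
  move=> x y e; have := hZ x; rewrite e hZ => eZ.
  case xZ : (x \in Z); first by apply: fI => //; rewrite -!hP ?e // eZ.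
  by have yZ := eZ; rewrite xZ in yZ; move: e; rewrite /h xZ yZ.
exists (perm hI); first exact: stable_perm_of_inj.
have pE v : exists2 x, (both f g v = g x) & both (on Z (perm hI)) (on Z id) v = on Z id x.
  case: v => x /=; last by exists x.
  exists (h x); rewrite /on ?hZ ?permE //; case xZ : (x \in Z); first by rewrite hP.
  have := fZ x; have := gZ (h x); rewrite hZ xZ.
  by case: (f x) => //; case: (g _).
apply: cpart_eq => [v|v w]; have [x -> ->] := pE v.
  by rewrite gZ /on; case: ifP.
rewrite gZ => xZ; have [y -> ->] := pE w; rewrite /on xZ.
apply/eqP/eqP => [e|]; first by rewrite (gI x y) ?xZ // -(gI x y) ?xZ.
by case: ifP => // _ [->].
Qed.

Lemma pmk_eq p Z : stable p Z ->
  pmk p Z = [set [set inl x; inr (p x)] | x in Z] :|: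
            ([set [set inl x] | x in ~: Z] :|: [set [set inr x] | x in ~: Z]).
Proof.
move=> st; rewrite /pmk /mk /cpart.
have E1 x : x \in Z -> cblk (both (on Z p) (on Z id)) (inl x) = [set inl x; inr (p x)].
  move=> xZ; apply/setP => -[y|y]; rewrite !inE /= /on xZ /=.
    rewrite [X in _ = _ || X](_ : _ = false) // orbF; apply: orb_idr.
    by case: ifP => // yZ /eqP[/perm_inj->].
  case: ifP => // yZ; apply/esym/eqP => -[e].
  by rewrite e st xZ in yZ.
have E2 y : y \in Z -> cblk (both (on Z p) (on Z id)) (inr y) =
     cblk (both (on Z p) (on Z id)) (inl ((p^-1)%g y)).
  move=> yZ; apply/cblk_eq; rewrite inE /= /on -st permKV yZ /= eqxx //.
have E3 v : both (on Z p) (on Z id) v = None -> cblk (both (on Z p) (on Z id)) v = [set v].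
  exact: cblk_None.
apply/setP => K; rewrite !inE; apply/imsetP/or3P => [[[x|y] _ ->]|].
- case xZ : (x \in Z); first by constructor 1; apply/imsetP; exists x; rewrite ?E1.
  by constructor 2; apply/imsetP; exists x; rewrite ?E3 ?inE ?xZ //= /on xZ.
- case yZ : (y \in Z); last first.
    by constructor 3; apply/imsetP; exists y; rewrite ?E3 ?inE ?yZ //= /on yZ.
  constructor 1; apply/imsetP; exists ((p^-1)%g y); first by rewrite -st permKV.
  by rewrite E2 // E1 // -st permKV.
- case=> /imsetP[x xZ ->].
  + by exists (inl x); rewrite ?E1.
  + by exists (inl x); rewrite ?E3 //= /on; rewrite inE in xZ; rewrite (negbTE xZ).
  + by exists (inr x); rewrite ?E3 //= /on; rewrite inE in xZ; rewrite (negbTE xZ).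
Qed.

Lemma Sset_SZ : Sset n = SZ [set: 'I_n].
Proof.
have E p : pmk p [set: 'I_n] = [set [set inl x; inr (p x)] | x : 'I_n].
  rewrite pmk_eq => [|x]; last by rewrite !inE.
  rewrite setCT !imset0 !setU0; apply/setP => K.
  by apply/imsetP/imsetP => -[x _ ->]; exists x; rewrite ?inE.
apply/setP => a; rewrite [_ \in Sset n]in_set; apply/existsP/idP => [[p /eqP->]|/SZ_pmk[p _ ->]].
  by rewrite -E; apply: pmk_SZ => x; rewrite !inE.
by exists p; rewrite E.
Qed.

Lemma SYset_SZ (t : 'I_n) : SYset t = SZ [set~ t].
Proof.
have stE p : p t = t <-> stable p [set~ t].
  split=> [e x|st]; first by rewrite !inE -{1}e (inj_eq perm_inj).
  by have := st t; rewrite !inE eqxx => /negbFE/eqP.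
have E p : p t = t -> pmk p [set~ t] =
   [set [set inl x; inr (p x)] | x in [set~ t]] :|: [set [set inl t]; [set inr t]].
  by move=> /stE st; rewrite pmk_eq // setCK !imset_set1.
apply/setP => a; rewrite [_ \in SYset t]in_set; apply/existsP/idP.
  by case=> p /andP[/eqP e /eqP->]; rewrite -E //; apply/pmk_SZ/stE.
by move=> /SZ_pmk[p /stE st ->]; exists p; rewrite st eqxx E /=.
Qed.

End Units.

(** * The listed sets as isolated subsemigroups, and tools for products of colourings *)

Section Goodness.
Variable n : nat.
Implicit Types (a b e : elt n) (A Z : {set 'I_n}) (T : {set elt n}).

Definition isolated_semigroup T := subsemigroup T /\ isolated T.

Lemma isolated_semigroup_eq T T' : isolated_semigroup T -> isolated_semigroup T' ->
  (forall e, e \in PIset n -> idem e -> (e \in T) = (e \in T')) -> T = T'.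
Proof.
have sub S S' : isolated_semigroup S -> isolated_semigroup S' ->
    (forall e, e \in PIset n -> idem e -> (e \in S) = (e \in S')) -> S \subset S'.
  move=> [[/subsetP sS [_ cS]] _] [_ iS'] E; apply/subsetP => a aS.
  have aP := sS _ aS; have [k ik] := pw_idem aP.
  by apply: (iS' a aP k); rewrite -E ?pw_PI //; apply: pw_closed.
move=> gT gT' E; apply/eqP; rewrite eqEsubset !sub // => e eP ie; by rewrite E.
Qed.

Lemma one_SZ Z : pmk 1%g Z \in SZ Z.
Proof. by apply: pmk_SZ => x; rewrite perm1. Qed.

Lemma SZ_isolated_semigroup Z : #|~: Z| <= 1 -> isolated_semigroup (SZ Z).
Proof.
move=> cZ; split; last exact: SZ_isolated.
split; first by apply/subsetP => a /SZP[].
split; first by apply/set0Pn; exists (pmk 1%g Z); apply: one_SZ.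
by move=> a b; apply: SZ_star.
Qed.

Lemma IZ_isolated_semigroup Z : #|~: Z| <= 1 -> isolated_semigroup (IZ Z).
Proof.
move=> cZ; split; last exact: IZ_isolated.
split; first by apply/subsetP => a /IZ_PI.
split; first by apply/set0Pn; exists (pmk 1%g Z); apply/SZ_IZ/one_SZ.
by move=> a b; apply: IZ_star.
Qed.

Lemma PI_isolated_semigroup : isolated_semigroup (PIset n).
Proof.
split=> //; split=> //; split; last by move=> a b; apply: star_PI.
by apply/set0Pn; exists (diag (fun _ => None : option unit)); apply: diag_PI.
Qed.

Lemma complement_isolated_semigroup Z T : bounded Z T -> isolated_semigroup T ->
  (exists2 a, a \in T & a \notin SZ Z) -> isolated_semigroup (T :\: SZ Z).
Proof.
move=> bT [[sT [_ cT]] iT] [a aT aS]; split; last exact: complement_isolated.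
split; first exact: subset_trans (subsetDl _ _) sT.
split; last exact: complement_star.
by apply/set0Pn; exists a; apply/setDP.
Qed.

Lemma diag_IZ (L : eqType) (f : 'I_n -> option L) Z :
  (diag f \in IZ Z) <-> (forall x, (f x != None) = (x \in Z)).
Proof.
split=> [/IZP[_ fZ /subsetP fD] x|fZ].
  apply/idP/idP => [nx|xZ].
    by have := fD _ (class_D nx); rewrite powersetE => /subsetP; apply; rewrite inE.
  move: fZ; rewrite idem_R ?diag_PI ?diag_idem // eqxx => /mem_D_diag/(_ (Some x) None) /=.
  by rewrite xZ; case: (f x) => // /(_ erefl).
apply/IZP; split; first exact: diag_PI.
  rewrite idem_R ?diag_PI ?diag_idem // eqxx.
  apply/(mem_D_mk _ (balanced_refl f)); exists predT => x; rewrite -fZ.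
  by case: (f x).
apply/subsetP => A /mem_D_diag fA; rewrite powersetE; apply/subsetP => x xA.
by rewrite -fZ; apply/eqP => e; have := fA (Some x) None e; rewrite /= xA.
Qed.

Lemma D_diag_inj (L : eqType) (f : 'I_n -> option L) Z :
  (forall x, (f x != None) = (x \in Z)) -> {in Z &, injective f} ->
  D (diag f) = powerset Z.
Proof.
move=> fZ fI; apply/eqP; rewrite eqEsubset.
have /diag_IZ/IZP[_ _ ->] := fZ; apply/subsetP => A; rewrite powersetE => /subsetP sA.
have z0 u : ext f u = None -> xin A u = false.
  case: u => //= x e; apply/negP => xA; have := sA x xA; rewrite -fZ e //.
apply/mem_D_diag => y z e; case E : (ext f y) => [l|]; last first.
  by rewrite !z0 // -e.
case: y z e E => [y|//] [z|] /= e E; last by rewrite e in E.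
rewrite (fI y z) // -fZ ?E // -e E //.
Qed.

Lemma bot_notin_SZ (L : eqType) (f : 'I_n -> option L) Z x y :
  x \in Z -> y \in Z -> x != y -> f x = f y -> diag f \notin SZ Z.
Proof.
move=> xZ yZ nxy e; apply/negP => /SZP[_ h _].
have : [set x] \in D (diag f) by rewrite h powersetE sub1set.
by move/mem_D_diag/(_ (Some x) (Some y) e) => /=; rewrite !inE eqxx eq_sym (negbTE nxy).
Qed.

Lemma two_elements Z : #|~: Z| <= 1 -> 2 < n -> exists x y, [/\ x \in Z, y \in Z & x != y].
Proof.
move=> cZ n3; have h : 1 < #|Z|.
  have e : #|Z| + #|~: Z| = n by rewrite cardsC card_ord.
  by have := leq_add (leqnn #|Z|) cZ; rewrite e addn1 => /(leq_trans n3).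
by case/card_gt1P: h => x [y [xZ yZ nxy]]; exists x, y.
Qed.

Lemma IZD_isolated_semigroup Z : #|~: Z| <= 1 -> 2 < n -> isolated_semigroup (IZ Z :\: SZ Z).
Proof.
move=> cZ n3; apply: complement_isolated_semigroup.
- exact: bounded_IZ.
- exact: IZ_isolated_semigroup.
have [x [y [xZ yZ nxy]]] := two_elements cZ n3.
(* The idempotent with the single class [Z], which is not a unit because [Z] has two elements. *)
exists (diag (on Z (fun _ => tt))); first by apply/diag_IZ => u; rewrite /on; case: ifP.
by apply: bot_notin_SZ nxy _ => //; rewrite /on xZ yZ.
Qed.

Lemma PID_isolated_semigroup : 2 < n -> isolated_semigroup (PIset n :\: SZ [set: 'I_n]).
Proof.
move=> n3; apply: complement_isolated_semigroup.
- exact: bounded_PI.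
- exact: PI_isolated_semigroup.
have [|x [y [xZ yZ nxy]]] := @two_elements [set: 'I_n] _ n3; first by rewrite setCT cards0.
exists (diag (fun _ => None : option unit)); first exact: diag_PI.
by apply: bot_notin_SZ nxy _.
Qed.

Lemma Gcl_isolated_semigroup Z e : #|~: Z| <= 1 -> 2 < n -> e \in IZ Z -> idem e ->
  rank e = #|Z|.-1 -> isolated_semigroup (Gcl e).
Proof.
move=> cZ n3 eI ie re; have eP := IZ_PI eI; split; last first.
  apply: (@Gcl_isolated _ Z) => //; have [x [y [xZ _ _]]] := two_elements cZ n3.
  by apply/card_gt0P; exists x.
split; first by apply/subsetP => a /(GclP _ eP ie)[].
split; last exact: Gcl_star.
by apply/set0Pn; exists e; apply: Gcl_id.
Qed.

Section Coloured.
Variable L : eqType.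

Lemma star_mk_comp (f : 'I_n -> option L) (g h : 'I_n -> option L) :
  balanced f g -> balanced g h -> star (mk f g) (mk g h) = mk f h.
Proof.
move=> bfg bgh; have [fg gf] := bfg; have [gh hg] := bgh.
have bfh : balanced f h.
  split=> x l; first by case/fg => y /gh.
  by case/hg => y /gf.
apply: R_inj; rewrite ?star_PI ?mk_PI // => A C.
apply/(R_star (mk_PI bfg) (mk_PI bgh))/idP => [[B]|].
  case=> /(R_mk _ _ bfg)[S [h1 h2]] /(R_mk _ _ bgh)[S' [h1' h2']].
  apply/(R_mk _ _ bfh); exists S; split=> // y; rewrite h2'.
  by case E : (h y) => [l|//]; have [x Ex] := hg _ _ E; have := h1' x; rewrite h2 Ex.
case/(R_mk _ _ bfh) => S [h1 h2]; exists [set y | oapp S false (g y)].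
by split; [apply/(R_mk _ _ bfg)|apply/(R_mk _ _ bgh)]; exists S; split=> // y; rewrite inE.
Qed.

Lemma R_mk_sym (f g : 'I_n -> option L) A B : balanced f g -> R (mk g f) A B = R (mk f g) B A.
Proof.
move=> bal; have bal' : balanced g f by case: bal.
by apply/idP/idP => [/(R_mk _ _ bal')|/(R_mk _ _ bal)] [S [h1 h2]];
  [apply/(R_mk _ _ bal); exists S|apply/(R_mk _ _ bal'); exists S].
Qed.

(** Every nonzero class is itself in the domain, so the domain separates inequivalent elements; at
    least one of two such elements has a nonzero class. *)
Lemma ext_eqP (f : 'I_n -> option L) y z :
  (forall A, A \in D (diag f) -> xin A y = xin A z) -> ext f y = ext f z.
Proof.
move=> h; have aux u w : ext f u != None -> (forall A, A \in D (diag f) -> xin A u = xin A w) ->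
    ext f u = ext f w.
  case: u => //= u nu /(_ _ (class_D nu)) /=; rewrite inE eqxx.
  by case: w => //= w; rewrite inE => /esym/eqP.
case: (eqVneq (ext f y) None) => [ey|ny]; last exact: aux.
case: (eqVneq (ext f z) None) => [ez|nz]; first by rewrite ey.
by apply/esym/aux => // A /h.
Qed.

End Coloured.

(** The idempotent that glues [c] to [d], or makes [c] a point when [d] is [None]. Multiplying an
    idempotent by it joins the classes of [c] and [d]. *)
Definition edge (c : 'I_n) (d : option 'I_n) : elt n :=
  diag (fun x => if x == c then d else Some x).

Lemma mem_D_edge c d A : (A \in D (edge c d)) = ((c \in A) == xin A d).
Proof.
apply/mem_D_mk/eqP => [|[S h]|h]; first exact: balanced_refl.
  rewrite h eqxx; case: d h => //= d h; rewrite h.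
  by case: ifP.
exists (mem A) => x; by have [->|//] := eqVneq x c; rewrite h.
Qed.

End Goodness.

(** * Splitting and conjugating idempotents *)

Section Classification.
Variable n : nat.
Variable T : {set elt n}.
Hypothesis Tgood : isolated_semigroup T.
Implicit Types (a b e : elt n) (A B C Z : {set 'I_n}).

Lemma T_PI a : a \in T -> a \in PIset n.
Proof. by case: Tgood => [[/subsetP s _] _] /s. Qed.

Lemma T_star a b : a \in T -> b \in T -> star a b \in T.
Proof. by case: Tgood => [[_ [_ cT]] _]; apply: cT. Qed.

Lemma T_sqrt a : a \in PIset n -> star a a \in T -> a \in T.
Proof. by case: Tgood => [_ iT] aP h; apply: (iT a aP 1). Qed.

(** If the square of [mk f g] is [e], then so is the square of its converse [mk g f]. Isolation puts
    both in [T], and their product is [diag f]. *)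
Lemma T_root (L : eqType) (f g : 'I_n -> option L) e : balanced f g ->
  e \in T -> idem e -> (forall A C, R (star (mk f g) (mk f g)) A C -> R e A C) ->
  (forall A C, R e A C -> R (star (mk f g) (mk f g)) A C) -> diag f \in T.
Proof.
move=> bal eT ie h1 h2; have bal' : balanced g f by case: bal.
have [[aP bP] eP] := (mk_PI bal, mk_PI bal', T_PI eT).
have aT : mk f g \in T.
  apply: T_sqrt => //; suff -> : star (mk f g) (mk f g) = e by [].
  by apply: R_inj => [||A C]; rewrite ?star_PI //; apply/idP/idP => [/h1|/h2].
have bT : mk g f \in T.
  apply: T_sqrt => //; suff -> : star (mk g f) (mk g f) = e by [].
  apply: R_inj => [||A C]; rewrite ?star_PI // (idem_R A C eP ie) eq_sym.
  have eC : (C == A) && (A \in D e) = R e C A.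
    by rewrite idem_R //; case: eqP => // ->.
  rewrite eC; apply/(R_star bP bP)/idP => [[B]|/h2/(R_star aP aP)[B [h h']]].
    by rewrite !(R_mk_sym _ _ bal) => -[h h']; apply/h1/(R_star aP aP); exists B.
  by exists B; rewrite !(R_mk_sym _ _ bal).
by rewrite /diag -(star_mk_comp bal bal'); apply: T_star.
Qed.

(* With [f'] obtained from [f] by moving the point [c] into the class of [d], the square of [mk f f'] is the join of the kernels of [f] and [f']. *)
Lemma T_split (L : eqType) (f : 'I_n -> option L) c c2 d :
  c2 != Some c -> ext f c2 = f c -> ext f d != f c ->
  star (diag f) (edge c d) \in T -> diag f \in T.
Proof.
move=> nc ec nd eT; pose f' x := if x == c then ext f d else f x.
have bal : balanced f f'.
  split=> x l e.
    (* Moving [c] away does not lose its colour: when there is one, the companion [c2] still carries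
       it. *)
    case: (eqVneq x c) => [ex|nx]; last by exists x; rewrite /f' (negbTE nx).
    subst x; case: c2 nc ec => [y|] /=; last by rewrite e.
    by move=> ny ey; exists y; rewrite /f' ifN // ey.
  move: e; rewrite /f'; case: ifP => _ e; last by exists x.
  by case: d {nd eT f'} e => // y ey; exists y.
have [fP gP] := (diag_PI f, diag_PI (fun x => if x == c then d else Some x)).
have [ie De] := idem_star fP (diag_idem _) gP (diag_idem _).
have ePI := T_PI eT; have aP := mk_PI bal.
apply: (T_root bal eT ie) => A C.
  case/(R_star aP aP) => B [/(R_mk _ _ bal)[S [h1 h2]] /(R_mk _ _ bal)[S' [h1' h2']]].
  have AE u : xin A u = oapp S false (ext f u) by case: u => //= x; rewrite -h1.
  have BE u : xin B u = oapp S' false (ext f u) by case: u => //= x; rewrite -h1'.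
  (* [c] and [c2] share a colour in [f], so [B] does not separate them. Read through [f'], this
     compares the value of [S] at the class of [d] with its value at the old class of [c]. *)
  have Scd : oapp S false (ext f d) = oapp S false (f c).
    have := BE (Some c); rewrite /= h2 /f' eqxx => ->; rewrite -[f c]ec -BE -AE.
    case: c2 nc ec => //= y ny ey; rewrite h2 h1 /f' ifN //.
  have eAB : A = B.
    by apply/setP => x; rewrite h1 h2 /f'; case: eqP => // ->.
  have eBC : A = C.
    apply/setP => x; rewrite h2' /f'; case: eqP => [->|_]; last by rewrite -h1' eAB.
    by rewrite -BE -eAB AE Scd h1.
  rewrite idem_R // eBC eqxx /= De -eBC in_setI mem_D_edge AE Scd -h1 eqxx andbT.
  by apply/(mem_D_mk _ (balanced_refl f)); exists S.
rewrite idem_R // De in_setI mem_D_edge => /andP[/eqP<- /andP[]].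
case/(mem_D_mk _ (balanced_refl f)) => S h1 /eqP hc.
have h2 x : (x \in A) = oapp S false (f' x).
  rewrite /f'; case: eqP => [->|_]; last exact: h1.
  by rewrite hc; case: d {nd eT f' bal De ie ePI aP gP hc} => //= y.
by apply/(R_star aP aP); exists A; split; apply/(R_mk _ _ bal); exists S.
Qed.

(* [sc] is the family of idempotents under consideration, and [K] the set of points (and possibly the zero) that may be glued without leaving it. *)
Section Down.
Variables (K : pred (option 'I_n)) (sc : elt n -> Prop).
Hypothesis Ksc : forall e c d, e \in PIset n -> idem e -> sc e -> K (Some c) -> K d ->
  sc (star e (edge c d)).
Hypothesis Kbot : forall e, e \in PIset n -> idem e -> sc e ->
  (forall A, A \in D e -> forall y z, K y -> K z -> xin A y = xin A z) -> e \in T.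

(** Induction on the size of the domain. Gluing [c] to some [d] in [K] outside its class gives a
    coarser idempotent, in [T] by induction, and [T_split] recovers [e]; the companion [c2] is what
    makes this splitting possible. When no such [d] is left, [Kbot] applies. *)
Lemma T_down e c c2 : e \in PIset n -> idem e -> sc e -> K (Some c) -> K c2 -> c2 != Some c ->
  (forall A, A \in D e -> xin A c2 = (c \in A)) -> e \in T.
Proof.
move: {2}#|D e|.+1 (ltnSn #|D e|) => m; elim: m e => // m IH e lm eP ie se Kc Kc2 nc hc.
have [f ef] := idem_diag eP ie.
case: (boolP [exists d, K d && (ext f d != f c)]) => [/existsP[d /andP[Kd nd]]|no].
  have gP := diag_PI (fun x => if x == c then d else Some x).
  have [ie' De'] := idem_star eP ie gP (diag_idem _).
  rewrite ef; apply: (T_split nc _ nd).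
    by apply: (@ext_eqP _ _ f c2 (Some c)) => A; rewrite -ef => /hc.
  rewrite -ef; apply: IH => //; first 1 last.
  - exact: star_PI.
  - exact: Ksc.
  - by move=> A; rewrite De' => /setIP[/hc].
  rewrite -ltnS; apply: leq_trans lm; rewrite ltnS De' proper_card //.
  rewrite properE subsetIl /=; apply: contra nd => /subsetP sub.
  apply/eqP/(@ext_eqP _ _ f d (Some c)) => A; rewrite -ef => /sub.
  by rewrite in_setI mem_D_edge => /andP[_ /eqP].
apply: Kbot => // A; rewrite ef => AD y z Ky Kz.
have E u : K u -> ext f u = f c.
  by move=> Ku; apply/eqP; move/existsPn/(_ u): no; rewrite Ku negbK.
by apply: (mem_D_diag _ _ AD); rewrite !E.
Qed.

End Down.

(** * Constraints on the least idempotent *)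

Section Minimum.
Variables (M : eqType) (h : 'I_n -> option M).
Hypothesis hT : diag h \in T.
Hypothesis hmin : forall e, e \in T -> idem e -> D (diag h) \subset D e.

(* Conjugating [diag h] by the transposition of the classes of [y] and [d] in [diag f] would glue [z] to [d]. *)
Lemma min_swap (L : eqType) (f : 'I_n -> option L) y z d : diag f \in T ->
  f y != None -> ext h z = h y -> ext f z != f y -> h d = None \/ h d = h y.
Proof.
move=> fT ny ez nz.
case: (eqVneq (h d) None) => [|nd]; first by left.
case: (eqVneq (h d) (h y)) => [|ndy]; [by right|exfalso].
have sD := subsetP (hmin fT (diag_idem f)).
have := class_D nd; set C := [set x | h x == h d] => CD.
have /mem_D_diag Cf := sD _ CD.
have dC : d \in C by rewrite inE.
have yC : y \notin C by rewrite inE eq_sym.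
have CE u : xin C u = (ext h u == h d).
  by case: u => [x|] /=; rewrite ?inE // eq_sym (negbTE nd).
case Ey : (f y) ny => [ly|//] _.
case Ed : (f d) => [ld|]; last by have := Cf (Some d) None Ed; rewrite /= dC.
have nl : ly != ld.
  by apply: contra yC => /eqP e; rewrite -[_ \in _]/(xin C (Some y)) (Cf (Some y) (Some d)) //= Ey Ed e.
(* [z] is not in the [f]-class of [d] either, since [h] already separates them; hence the
   transposition [s] below leaves the class of [z] alone. *)
have nzd : ext f z != Some ld.
  apply/eqP => e; have := Cf z (Some d); rewrite /= Ed => /(_ e); rewrite dC CE ez.
  by rewrite eq_sym (negbTE ndy).
pose s l := if l == ly then ld else if l == ld then ly else l.
have ss : involutive s.
  move=> l; rewrite /s; case: (eqVneq l ly) => [->|n1].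
    by rewrite eq_sym (negbTE nl) eqxx.
  by case: (eqVneq l ld) => [->|n2]; rewrite ?eqxx // (negbTE n1) (negbTE n2).
pose g x := omap s (f x).
have fg x : f x = omap s (g x) by rewrite /g; case: (f x) => //= l; rewrite ss.
have sr l x : f x = Some l -> exists x', f x' = Some (s l).
  rewrite /s; case: ifP => _; first by exists d.
  by case: ifP => _; [exists y|exists x].
have bal : balanced f g.
  split=> x l; first by move/sr => [x' e]; exists x'; rewrite /g e /= ss.
  by rewrite /g; case E : (f x) => [k|] //= [<-]; apply: sr E.
have bal' : balanced g f by case: bal.
have eq_gf : mk f g = mk g f.
  have E v : both g f v = omap s (both f g v) by case: v => x //=.
  apply: cpart_eq => [v|v w nv]; rewrite !E; first by case: (both f g v).
  case: (both f g v) nv => // l _; case: (both f g w) => //= k.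
  by rewrite -[RHS]/(s k == s l) (inj_eq (inv_inj ss)).
(* The transposition is its own inverse, so its square is [diag f] and isolation puts it in [T]. *)
have sq : star (mk f g) (mk f g) = diag f by rewrite {2}eq_gf star_mk_comp.
have gP := mk_PI bal; have gT : mk f g \in T by apply: T_sqrt; rewrite ?sq.
have hP := T_PI hT.
have xT : star (mk f g) (star (diag h) (mk f g)) \in T by do !apply: T_star.
have hgP := star_PI hP gP.
have xR A B : R (star (mk f g) (star (diag h) (mk f g))) A B ->
    A = B /\ exists2 P, P \in D (diag h) & R (mk f g) A P.
  case/(R_star gP hgP) => P [h1 /(R_star hP gP)[P' []]].
  rewrite (idem_R _ _ hP (diag_idem h)) => /andP[/eqP<- PD] h2; split; last by exists P.
  have : R (diag f) A B by rewrite -sq; apply/(R_star gP gP); exists P.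
  by rewrite (idem_R _ _ (diag_PI f) (diag_idem f)) => /andP[/eqP].
have ix : idem (star (mk f g) (star (diag h) (mk f g))).
  by apply: idemP; [apply: T_PI|move=> A B /xR[]].
(* By minimality the class [C] of [d] is in the domain of the conjugate. Its image [P] contains [y],
   hence also [z]; as the swap fixes the class of [z], this puts [z] in [C], a contradiction. *)
have /DP[B /xR[_ [P PD]]] := subsetP (hmin xT ix) _ CD.
case/(R_mk _ _ bal) => S [h1 h2].
have Sd : S ld by have := h1 d; rewrite dC Ed.
have yP : y \in P by rewrite h2 /g Ey /= /s eqxx.
have : xin P z by rewrite (mem_D_diag _ _ PD z (Some y)) ?ez.
case: z ez nz nzd => //= z ez nz nzd; rewrite h2 /g.
case E : (f z) nz nzd => [l|//] /= nz nzd; rewrite /s ifN; last by move: nz; rewrite Ey.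
rewrite ifN // => Sl; have := h1 z; rewrite E /= Sl inE ez eq_sym.
by rewrite (negbTE ndy).
Qed.

(** Makes [y] a nonzero class of its own, with the fresh colour [Some None]; an old colour [l]
    becomes [Some (Some l)]. *)
Definition isolate (y : 'I_n) x : option (option M) :=
  if x == y then Some None else omap Some (h x).

Lemma ext_isolate y u : u != Some y -> ext (isolate y) u = omap Some (ext h u).
Proof. by case: u => //= x nx; rewrite /isolate ifN. Qed.

Lemma D_isolate y z A : z != Some y -> ext h z = h y ->
  (A \in D (diag h)) = (A \in D (diag (isolate y))) && ((y \in A) == xin A z).
Proof.
move=> nz ez; apply/mem_D_diag/andP => [H|[/mem_D_diag H /eqP hy] u w e].
  split; last by apply/eqP; rewrite -(H (Some y) z).
  apply/mem_D_diag => u w e; apply: H.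
  pose G (o : option (option M)) := if o is Some o' then (if o' is Some l then Some l else h y) else None.
  have E v : ext h v = G (ext (isolate y) v).
    case: v => //= x; rewrite /isolate; case: eqP => [->//|_].
    by case: (h x).
  by rewrite !E e.
(* Replacing [y] by [z] changes neither the colour under [h] nor membership in [A], and reduces to
   elements other than [y]. *)
pose r v := if v == Some y then z else v.
have rx v : xin A (r v) = xin A v by rewrite /r; case: eqP => // ->; rewrite /= hy.
have rh v : ext h (r v) = ext h v by rewrite /r; case: eqP => // ->.
have rn v : r v != Some y by rewrite /r; case: ifP => // ->.
by rewrite -rx -[RHS]rx; apply: H; rewrite !ext_isolate // !rh e.
Qed.

(** The class has three distinct members [y], [c] and [c2], the last possibly the zero. After [y] is
    split off, [c] keeps the companion [c2], and gluing [c] back to [y] gives [diag h], so [T_split]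
    applies. *)
Lemma T_isolate c y c2 : c != y -> c2 != Some c -> c2 != Some y ->
  h c = h y -> ext h c2 = h y -> diag (isolate y) \in T.
Proof.
move=> ncy nc nc2 ec ec2; apply: (@T_split _ (isolate y) c c2 (Some y)) => //.
- by rewrite ext_isolate // ec2 /isolate ifN // ec.
- by rewrite /= /isolate eqxx ifN //; case: (h c).
suff -> : star (diag (isolate y)) (edge c (Some y)) = diag h by [].
have fP := diag_PI (isolate y).
have gP := diag_PI (fun x => if x == c then Some y else Some x).
have [ie De] := idem_star fP (diag_idem _) gP (diag_idem _).
apply: idem_D_inj; rewrite ?star_PI ?diag_PI ?diag_idem //.
apply/setP => A; rewrite De in_setI mem_D_edge (@D_isolate y (Some c)) //.
by congr (_ && _); rewrite eq_sym.
Qed.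

(** The idempotent splitting off [y] lies in [T], and exchanging [y] there with another nonzero
    class would disturb the kernel of the minimum. *)
Lemma min_class3 c y c2 d : c != y -> c2 != Some c -> c2 != Some y ->
  h c = h y -> ext h c2 = h y -> h d = None \/ h d = h y.
Proof.
move=> ncy nc nc2 ec ec2; have fT := T_isolate ncy nc nc2 ec ec2.
apply: (min_swap (z := Some c) d fT) => //; rewrite /= /isolate eqxx //.
by rewrite ifN //; case: (h c).
Qed.

(* [mk f f'] below maps the class {c1, c2} of [h] onto the class {d1, d2} and the two halves of the latter onto the two halves of the former. *)
Lemma T_isolate2 c1 c2 d1 d2 : c1 != c2 -> d1 != d2 -> h c1 = h c2 -> h d1 = h d2 ->
  h c1 != None -> h d1 != None -> h c1 != h d1 -> diag (isolate d1) \in T.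
Proof.
move=> nc nd ec ed.
case Ec : (h c1) => [k|//] _; case Ed : (h d1) => [l|//] _ nkl.
have Ec2 : h c2 = Some k by rewrite -ec.
have Ed2 : h d2 = Some l by rewrite -ed.
have {}nkl : k != l by apply: contra nkl => /eqP->.
pose s j := if j == k then l else if j == l then k else j.
have ss : involutive s.
  move=> j; rewrite /s; case: (eqVneq j k) => [->|n1].
    by rewrite eq_sym (negbTE nkl) eqxx.
  by case: (eqVneq j l) => [->|n2]; rewrite ?eqxx // (negbTE n1) (negbTE n2).
have sk : s k = l by rewrite /s eqxx.
have sl : s l = k by rewrite -sk ss.
have sr j x : h x = Some j -> exists x', h x' = Some (s j).
  rewrite /s; case: ifP => _; first by exists d1.
  by case: ifP => _; [exists c1|exists x].
pose f := isolate d1.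
pose f' x := if x == c1 then Some None else omap (Some \o s) (h x).
have f'E x : x != c1 -> f' x = omap (Some \o s) (h x) by move=> nx; rewrite /f' ifN.
have fE x : x != d1 -> f x = omap Some (h x) by move=> nx; rewrite /f /isolate ifN.
have f'c : f' c1 = Some None by rewrite /f' eqxx.
have fd : f d1 = Some None by rewrite /f /isolate eqxx.
have f'c2 : f' c2 = Some (Some l) by rewrite f'E 1?eq_sym // Ec2 /= sk.
have fd2 : f d2 = Some (Some l) by rewrite fE 1?eq_sym // Ed2.
have bal : balanced f f'.
  split=> x o.
    rewrite /f /isolate; case: ifP => [_ [<-]|_]; first by exists c1.
    case E : (h x) => [j|] //= [<-]; have [x' e] := sr _ _ E.
    case: (eqVneq x' c1) => [ex|nx]; last by exists x'; rewrite f'E // e /= ss.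
    by exists c2; rewrite f'c2; move: e; rewrite ex Ec => -[ek]; rewrite -(ss j) -ek sk.
  rewrite /f'; case: ifP => [_ [<-]|_]; first by exists d1.
  case E : (h x) => [j|] //= [<-]; have [x' e] := sr _ _ E.
  case: (eqVneq x' d1) => [ex|nx]; last by exists x'; rewrite fE // e.
  by exists d2; rewrite fd2; move: e; rewrite ex Ed => -[ek]; rewrite -ek.
have aP := mk_PI bal; have hP := T_PI hT.
apply: (T_root bal hT (diag_idem h)) => A C.
  case/(R_star aP aP) => B [/(R_mk _ _ bal)[S [h1 h2]] /(R_mk _ _ bal)[S' [h1' h2']]].
  (* [c1] and [c2] have the same colour in [f] but the colours of the two halves in [f'], so [S]
     cannot tell the halves apart. The same argument with [d1] and [d2] serves for [S']. *)
  have SN : S None = S (Some l).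
    have := h1' c1; have := h1' c2; rewrite !h2 f'c f'c2 /=.
    have cd u : h u = Some k -> u != d1 by move=> eu; apply: contraNneq nkl => e; move: eu; rewrite e Ed => -[->].
    by rewrite !fE ?cd // Ec Ec2 /= => -> ->.
  have S'N : S' None = S' (Some l).
    have := h1' d1; have := h1' d2; rewrite !h2 fd fd2 /=.
    have dc u : h u = Some l -> u != c1 by move=> eu; apply: contraNneq nkl => e; move: eu; rewrite e Ec => -[->].
    by rewrite !f'E ?dc // Ed Ed2 /= => -> ->.
  have AE x : (x \in A) = oapp (S \o Some) false (h x).
    rewrite h1; case: (eqVneq x d1) => [->|nx]; first by rewrite fd Ed /= SN.
    by rewrite fE //; case: (h x).
  have BE x : (x \in B) = oapp (S \o Some \o s) false (h x).
    rewrite h2; case: (eqVneq x c1) => [->|nx]; first by rewrite f'c Ec /= SN sk.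
    by rewrite f'E //; case: (h x).
  have BE' x : (x \in B) = oapp (S' \o Some) false (h x).
    rewrite h1'; case: (eqVneq x d1) => [->|nx]; first by rewrite fd Ed /= S'N.
    by rewrite fE //; case: (h x).
  have CE x : (x \in C) = oapp (S' \o Some \o s) false (h x).
    rewrite h2'; case: (eqVneq x c1) => [->|nx]; first by rewrite f'c Ec /= S'N sk.
    by rewrite f'E //; case: (h x).
  rewrite (idem_R _ _ hP (diag_idem h)); apply/andP; split; last first.
    by apply/(mem_D_mk _ (balanced_refl h)); exists (S \o Some).
  apply/eqP/setP => x; rewrite AE CE; case E : (h x) => [j|] //=.
  by have [x' e] := sr _ _ E; have := BE x'; rewrite BE' e /= ss => ->.
rewrite (idem_R _ _ hP (diag_idem h)) => /andP[/eqP<-].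
case/(mem_D_mk _ (balanced_refl h)) => S hS.
(* Lifts a set of colours of [h] to the split colours, treating both halves of the class of [d1]
   alike. *)
pose Q (S0 : pred M) (o : option M) := if o is Some j then S0 j else S0 l.
have QE x : oapp (Q S) false (f x) = (x \in A).
  rewrite hS; case: (eqVneq x d1) => [->|nx]; first by rewrite fd Ed.
  by rewrite fE //; case: (h x).
pose B := [set x | oapp (S \o s) false (h x)].
have QB x : oapp (Q S) false (f' x) = (x \in B).
  rewrite inE; case: (eqVneq x c1) => [->|nx]; first by rewrite f'c Ec /= sk.
  by rewrite f'E //; case: (h x).
have QB' x : oapp (Q (S \o s)) false (f x) = (x \in B).
  rewrite inE; case: (eqVneq x d1) => [->|nx]; first by rewrite fd Ed.
  by rewrite fE //; case: (h x).
have QA x : oapp (Q (S \o s)) false (f' x) = (x \in A).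
  rewrite hS; case: (eqVneq x c1) => [->|nx]; first by rewrite f'c Ec /= sl.
  by rewrite f'E //; case: (h x) => //= j; rewrite ss.
apply/(R_star aP aP); exists B; split; apply/(R_mk _ _ bal).
  by exists (Q S); split=> x; rewrite ?QE ?QB.
by exists (Q (S \o s)); split=> x; rewrite ?QB' ?QA.
Qed.

End Minimum.
End Classification.

(** * The classification *)

Section Cases.
Variable n : nat.
Variable T : {set elt n}.
Hypothesis Tgood : isolated_semigroup T.
Implicit Types (a b e : elt n) (A B C Z : {set 'I_n}).

(** An idempotent of [T] with smallest domain is the least one: its product with any other
    idempotent of [T] has the intersection as domain. *)
Lemma exists_min_idem : exists2 e0, e0 \in T /\ idem e0 &
  forall e, e \in T -> idem e -> D e0 \subset D e.
Proof.
have [[_ [/set0Pn[a aT] cT]] _] := Tgood.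
have [k ik] := pw_idem (T_PI Tgood aT).
have kT : pw a k \in T by apply: pw_closed.
have k0 : (pw a k \in T) && idem (pw a k) by rewrite kT.
case: (@arg_minnP _ (pw a k) (fun e => (e \in T) && idem e) (fun e => #|D e|) k0) => m /andP[mT im] mmin.
exists m => // e eT ie; have [mP eP] := (T_PI Tgood mT, T_PI Tgood eT).
have [ime Dme] := idem_star mP im eP ie.
have := mmin (star m e); rewrite ime (T_star Tgood) //= => /(_ isT) le.
apply/setIidPl; rewrite -Dme; apply/eqP; rewrite eqEcard le andbT Dme.
exact: subsetIl.
Qed.

Lemma diag_on_id Z : diag (on Z id) \in SZ Z.
Proof.
have hZ x : (on Z id x != None) = (x \in Z) by rewrite /on; case: ifP.
apply: SZ_of_D; first exact: diag_PI.
  by apply: IZ_D'; apply/diag_IZ.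
apply: D_diag_inj hZ _ => x y xZ yZ; rewrite /on xZ yZ => -[].
by [].
Qed.

Lemma SZ_idem Z e : e \in PIset n -> idem e -> D e = powerset Z -> e = diag (on Z id).
Proof.
move=> eP ie eD; apply: idem_D_inj; rewrite ?diag_PI ?diag_idem // eD.
by case/SZP: (diag_on_id Z).
Qed.

(** The only idempotent of [SZ Z] is the identity on [Z]; whether [T] contains it decides between
    the two outcomes. *)
Lemma T_upto_units Z (B : {set elt n}) : bounded Z B -> isolated_semigroup B -> SZ Z \subset B ->
  (forall e, e \in T -> idem e -> e \in B) ->
  (forall e, e \in B -> idem e -> D e <> powerset Z -> e \in T) ->
  T = B \/ T = B :\: SZ Z.
Proof.
move=> bB gB sB TB BT; have BP e : e \in B -> e \in PIset n by case/bB.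
case: (boolP (diag (on Z id) \in T)) => oneT; [left|right].
  apply: isolated_semigroup_eq => // e eP ie; apply/idP/idP => [eT|eB]; first exact: TB.
  case: (D e =P powerset Z) => [eD|]; last exact: BT.
  by rewrite (SZ_idem eP ie eD).
have TS e : e \in T -> idem e -> e \notin SZ Z.
  move=> eT ie; apply: contra oneT => /SZP[eP eD _].
  by rewrite -(SZ_idem eP ie eD).
have [e0 [e0T ie0] _] := exists_min_idem.
apply: isolated_semigroup_eq => //.
  by apply: complement_isolated_semigroup => //; exists e0; [apply: TB|apply: TS].
move=> e eP ie; apply/idP/setDP => [eT|[eB eS]]; first by rewrite TB ?TS.
apply: BT => // eD; case/negP: eS; rewrite (SZ_idem eP ie eD).
exact: diag_on_id.
Qed.

Lemma idem_nontrivial (L : eqType) (f : 'I_n -> option L) Z :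
  (forall x, (f x != None) = (x \in Z)) -> D (diag f) <> powerset Z ->
  exists x y, [/\ x \in Z, y \in Z, x != y & f x = f y].
Proof.
move=> fZ nD; case: (boolP [exists x, exists y, [&& x \in Z, y \in Z, x != y & f x == f y]]).
  by case/existsP => x /existsP[y /and4P[xZ yZ nxy /eqP e]]; exists x, y.
move=> no; case: nD; apply: D_diag_inj => // x y xZ yZ e; apply/eqP/negPn.
apply/negP => nxy; move/existsPn/(_ x)/existsPn/(_ y): no.
by rewrite xZ yZ nxy e eqxx.
Qed.

(** * Cases according to the kernel of the least idempotent *)

Section Bottom.
Variables (M : eqType) (h : 'I_n -> option M).
Hypothesis hT : diag h \in T.
Hypothesis hmin : forall e, e \in T -> idem e -> D (diag h) \subset D e.

(** The points [t], [s] and the zero form a class of three, so by [min_class3] the minimum consists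
    of points only. Every nonidentity idempotent is then reached by [T_down] with all gluings
    allowed. *)
Lemma total_case t s : t != s -> h t = None -> h s = None ->
  T = PIset n \/ T = PIset n :\: SZ [set: 'I_n].
Proof.
move=> nts et es.
have h0 d : h d = None.
  by have [//|->] := min_class3 Tgood hT hmin (c2 := None) d nts isT isT (etrans et (esym es)) (esym es).
have D0 e : e \in PIset n -> idem e -> (forall A, A \in D e -> forall x, x \notin A) -> e = diag h.
  move=> eP ie e0; apply: idem_D_inj; rewrite ?diag_PI ?diag_idem //.
  apply/setP => A; apply/idP/idP => [/e0 A0|/mem_D_diag AD].
    by apply/mem_D_diag => -[x|] [y|] _ //=; rewrite ?(negbTE (A0 _)).
  have -> : A = set0 by apply/setP => x; rewrite inE; apply: (AD (Some x) None); apply: h0.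
  apply/DP; exists set0; apply/satP => K Ke v vK.
  by case: v {vK} => w; rewrite !inE.
apply: T_upto_units; [exact: bounded_PI|exact: PI_isolated_semigroup| | |].
- by apply/subsetP => a /SZP[].
- by move=> e eT _; apply: (T_PI Tgood).
move=> e eP ie nD; have [f ef] := idem_diag eP ie.
(* Either some [c] is a point and the zero is its companion, or two elements of X share a class. *)
have [c [c2 [nc ec]]] : exists c c2, c2 != Some c /\ ext f c2 = f c.
  case: (boolP [forall x, f x != None]) => [/forallP fn|].
    have fZ x : (f x != None) = (x \in [set: 'I_n]) by rewrite fn inE.
    rewrite ef in nD; have [x [y [_ _ nxy e1]]] := idem_nontrivial fZ nD.
    by exists x, (Some y); rewrite /= e1; split=> //; apply: contra nxy => /eqP[->].
  by case/forallPn => x /negPn/eqP fx; exists x, None; rewrite fx.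
apply: (@T_down _ _ Tgood predT (fun _ => True) _ _ e c c2) => //.
- move=> e1 e1P ie1 _ e0; rewrite (D0 e1) // => A AD x.
  by rewrite -[x \in A]/(xin A (Some x)) (e0 A AD (Some x) None).
- by move=> A; rewrite ef => /mem_D_diag/(_ c2 (Some c) ec).
Qed.

Hypothesis n3 : 2 < n.
Let Z := [set x | h x != None].
Hypothesis cZ : #|~: Z| <= 1.

Lemma hZ x : (h x != None) = (x \in Z).
Proof. by rewrite inE. Qed.

(** If a point of [h] lay on a line of [f], it could be exchanged with a class inside [Z], against
    [min_swap] with the zero as [z]. Conversely [Z] is in every domain, by minimality. *)
Lemma T_support (L : eqType) (f : 'I_n -> option L) : diag f \in T ->
  forall x, (f x != None) = (x \in Z).
Proof.
move=> fT x; apply/idP/idP => [nx|xZ].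
  rewrite inE; apply/eqP => hx.
  have [y [_ [yZ _ _]]] := two_elements cZ n3.
  have [] := min_swap Tgood hT hmin (z := None) y fT nx (esym hx) _.
  - by rewrite eq_sym.
  - by move=> e; move: yZ; rewrite inE e.
  - by rewrite hx => e; move: yZ; rewrite inE e.
have ZD : Z \in D (diag f).
  apply: (subsetP (hmin fT (diag_idem f))); apply/(mem_D_mk _ (balanced_refl h)).
  by exists predT => y; rewrite inE; case: (h y).
by apply/eqP => e; move/mem_D_diag/(_ (Some x) None e): ZD; rewrite /= xZ.
Qed.

Lemma T_idem_IZ e : e \in T -> idem e -> e \in IZ Z.
Proof.
move=> eT ie; have [f ef] := idem_diag (T_PI Tgood eT) ie.
by rewrite ef; apply/diag_IZ/T_support; rewrite -ef.
Qed.

Lemma min_IZ : diag h \in IZ Z.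
Proof. exact/diag_IZ/hZ. Qed.

Lemma units_case : {in Z &, injective h} -> T = SZ Z.
Proof.
move=> hI; have hD := D_diag_inj hZ hI.
apply: isolated_semigroup_eq => //; first exact: SZ_isolated_semigroup.
move=> e eP ie; apply/idP/idP => [eT|/SZP[_ eD _]].
  have eI := T_idem_IZ eT ie; apply: SZ_of_D => //; first exact: IZ_D'.
  by apply/eqP; rewrite eqEsubset -{2}hD hmin // andbT; case/IZP: eI.
by rewrite (_ : e = diag h) //; apply: idem_D_inj; rewrite ?diag_PI ?diag_idem ?hD.
Qed.

(** The minimum has the single class [Z]. A nonidentity idempotent of [IZ Z] has two elements of [Z]
    in one class, so [T_down] with gluings inside [Z] reaches it. *)
Lemma bottom_case : (forall x y, x \in Z -> y \in Z -> h x = h y) ->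
  T = IZ Z \/ T = IZ Z :\: SZ Z.
Proof.
move=> hc.
have Dbot e : e \in IZ Z -> (forall A, A \in D e -> forall x y, x \in Z -> y \in Z -> (x \in A) = (y \in A)) ->
    D e = [set set0; Z].
  move=> /IZP[eP eZ /subsetP eD] ec; apply/setP => A; rewrite in_set2; apply/DP/orP.
    move=> [B AB]; have AD : A \in D e by apply/DP; exists B.
    have := eD _ AD; rewrite powersetE => sA.
    case: (set_0Vmem A) => [->|[x xA]]; [by left|right].
    rewrite eqEsubset sA; apply/subsetP => y yZ.
    by rewrite -(ec A AD x y) // (subsetP sA).
  case=> /eqP->; last by exists Z.
  exists set0; apply/satP => K Ke v vK.
  by case: v {vK} => w; rewrite !inE.
have hD : D (diag h) = [set set0; Z].
  apply: Dbot min_IZ _ => A /mem_D_diag AD x y xZ yZ.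
  exact: (AD (Some x) (Some y) (hc x y xZ yZ)).
apply: T_upto_units; [exact: bounded_IZ|exact: IZ_isolated_semigroup| | |].
- by apply/subsetP => a /SZ_IZ.
- exact: T_idem_IZ.
move=> e eI ie nD; have eP := IZ_PI eI; have [f ef] := idem_diag eP ie.
have fZ : forall x, (f x != None) = (x \in Z) by apply/diag_IZ; rewrite -ef.
have [c [c2 [cZ1 c2Z nc ec]]] : exists x y, [/\ x \in Z, y \in Z, x != y & f x = f y].
  by apply: idem_nontrivial fZ _; rewrite -ef.
pose K (z : option 'I_n) := xin Z z.
apply: (@T_down _ _ Tgood K (fun e => e \in IZ Z) _ _ e c (Some c2)) => //.
- move=> e1 c1 d1 e1P ie1 /IZP[_ e1Z e1D] Kc Kd.
  have gP := diag_PI (fun x => if x == c1 then d1 else Some x).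
  have [ie' De'] := idem_star e1P ie1 gP (diag_idem _).
  apply/IZP; split; first exact: star_PI.
    rewrite idem_R ?star_PI // eqxx De' in_setI mem_D_edge -/(K d1) Kd.
    rewrite -[c1 \in Z]/(K (Some c1)) Kc andbT.
    by apply/DP; exists Z.
  by rewrite De' subIset // e1D.
- move=> e1 e1P ie1 e1I e1c.
  rewrite (_ : e1 = diag h) //; apply: idem_D_inj; rewrite ?diag_PI ?diag_idem // hD.
  by apply: Dbot => // A AD x y xZ yZ; apply: (e1c A AD (Some x) (Some y)).
- by apply: contra nc => /eqP[->].
- by move=> A; rewrite ef => /mem_D_diag/(_ (Some c2) (Some c) (esym ec)).
Qed.

(** As there are two nonzero classes, [min_swap] forbids any refinement of [h], so [diag h] is the
    only idempotent of [T]. A third member of the class of [i], or a second nontrivial class in [Z],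
    would permit a splitting inside [T]; hence [i] and [j] form the only nontrivial class. *)
Lemma group_case i j x y : i \in Z -> j \in Z -> i != j -> h i = h j ->
  x \in Z -> y \in Z -> h x != h y ->
  [/\ diag h \in IZ Z, idem (diag h), rank (diag h) = #|Z|.-1 & T = Gcl (diag h)].
Proof.
move=> iZ jZ nij eij xZ yZ nxy.
have hP := diag_PI h.
have Dm (L : eqType) (f : 'I_n -> option L) : diag f \in T -> forall u w, ext h u = ext h w -> ext f u = ext f w.
  move=> fT.
  have aux u w : u \in Z -> ext h w = h u -> ext f w = f u.
    move=> uZ e; apply/eqP/negPn/negP => ne.
    have nu : f u != None by rewrite (T_support fT).
    have sw d := min_swap Tgood hT hmin (z := w) d fT nu e ne.
    have eqZ d : d \in Z -> h d = h u by move=> dZ; case: (sw d) => // e0; move: dZ; rewrite inE e0.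
    by move: nxy; rewrite !eqZ ?eqxx.
  move=> [u|] [w|] //= e.
  - case: (boolP (w \in Z)) => wZ; first exact: (aux w (Some u)).
    have uZ : u \notin Z by move: wZ; rewrite !inE e.
    by move: wZ uZ; rewrite -!(T_support fT) !negbK => /eqP-> /eqP->.
  - have : u \notin Z by rewrite inE e.
    by rewrite -(T_support fT) negbK => /eqP.
  - have : w \notin Z by rewrite inE -e.
    by rewrite -(T_support fT) negbK => /eqP.
have eqm e : e \in T -> idem e -> e = diag h.
  move=> eT ie; have [f ef] := idem_diag (T_PI Tgood eT) ie.
  apply: idem_D_inj; rewrite ?diag_PI ?diag_idem ?(T_PI Tgood) //.
  apply/eqP; rewrite eqEsubset hmin // andbT; apply/subsetP => A; rewrite ef => /mem_D_diag AD.
  by apply/mem_D_diag => u w /(Dm _ f) e1; apply: AD; apply: e1; rewrite -ef.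
have pair u w : u \in Z -> w \in Z -> u != w -> h u = h w -> u \in [set i; j].
  move=> uZ wZ nuw e.
  have fine v k : diag (isolate h v) \in T -> k != v -> h k = h v -> False.
    move=> vT nkv ekv; have := Dm _ _ vT (Some k) (Some v) ekv.
    by rewrite /= /isolate eqxx ifN //; case: (h k).
  case: (eqVneq (h u) (h i)) => [eui|nui].
    rewrite !inE; apply/negPn/negP; rewrite negb_or => /andP[nui nuj].
    apply: (fine j i) => //; apply: (T_isolate Tgood hT (c2 := Some u) nij) => //.
    by rewrite /= eui.
  exfalso; apply: (fine u w); rewrite 1?eq_sym // ?e //.
  by apply: (T_isolate2 Tgood hT nij nuw) => //; rewrite ?hZ // eq_sym.
have hD A : (A \in D (diag h)) = (A \subset Z) && ((i \in A) == (j \in A)).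
  apply/idP/andP => [AD|[sA /eqP eA]].
    split; last by apply/eqP; apply: (mem_D_diag _ _ AD (Some i) (Some j)).
    by case/IZP: min_IZ => _ _ /subsetP/(_ _ AD); rewrite powersetE.
  have A0 u : u \notin Z -> (u \in A) = false.
    by move=> uZ; apply: contraNF uZ; apply: (subsetP sA).
  have key u w : h u = h w -> (u \in A) = (w \in A).
    move=> e; case: (boolP (u \in Z)) => uZ; last first.
      by rewrite !A0 //; move: uZ; rewrite !inE e.
    have wZ : w \in Z by move: uZ; rewrite !inE e.
    case: (eqVneq u w) => [->//|nuw].
    have := pair u w uZ wZ nuw e; have := pair w u wZ uZ; rewrite eq_sym => /(_ nuw (esym e)).
    by rewrite !inE => /orP[]/eqP-> /orP[]/eqP->; rewrite ?eA.
  apply/mem_D_diag => -[u|] [w|] //= e; first exact: key.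
    by apply: A0; rewrite inE e.
  by rewrite A0 // inE -e.
have rk : rank (diag h) = #|Z|.-1.
  apply/eqP; rewrite -(eqn_exp2l (m := 2)) // -card_D //.
  have -> : #|Z|.-1 = #|Z :\ j| by rewrite [in LHS](cardsD1 j) jZ.
  rewrite -card_powerset.
  (* Membership of [j] is dictated by that of [i], so deleting [j] maps the domain bijectively onto
     the subsets of [Z :\ j]. *)
  have inj : {in D (diag h) &, injective (fun A => A :\ j)}.
    move=> A B; rewrite !hD => /andP[_ /eqP eA] /andP[_ /eqP eB] /setP e.
    apply/setP => u; case: (eqVneq u j) => [->|nu]; last by have := e u; rewrite !inE nu.
    by have := e i; rewrite !inE nij eA eB.
  rewrite -(card_in_imset inj); apply/eqP; congr #|pred_of_set _|; apply/setP => B.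
  rewrite powersetE; apply/imsetP/idP => [[A + ->]|sB].
    by rewrite hD => /andP[sA _]; apply: setSD.
  have [sBZ jB] : B \subset Z /\ j \notin B by apply/andP; rewrite -subsetD1.
  exists (if i \in B then j |: B else B); last first.
    by case: ifP => _; rewrite ?setU1K //; apply/esym/setDidPl; rewrite disjoint_sym disjoints1.
  rewrite hD; case: ifP => iB; last by rewrite sBZ iB (negbTE jB).
  by rewrite subUset sub1set jZ sBZ !inE iB eqxx orbT.
split; [exact: min_IZ|exact: diag_idem|exact: rk|].
apply: isolated_semigroup_eq => //.
  exact: (Gcl_isolated_semigroup cZ n3 min_IZ (diag_idem h) rk).
move=> e eP ie; apply/idP/(GclP _ hP (diag_idem h)) => [eT|[_ eD _]].
  by rewrite (eqm e eT ie) idem_D' // diag_idem.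
by rewrite (_ : e = diag h) //; apply: idem_D_inj; rewrite ?diag_idem.
Qed.

End Bottom.

Lemma classification : 2 < n ->
  (T = PIset n \/ T = PIset n :\: SZ [set: 'I_n]) \/
  exists2 Z, #|~: Z| <= 1 &
    [\/ T = IZ Z, T = IZ Z :\: SZ Z, T = SZ Z
      | exists2 e, [/\ e \in IZ Z, idem e & rank e = #|Z|.-1] & T = Gcl e].
Proof.
move=> n3; have [m [mT im] mmin] := exists_min_idem.
have [h eh] := idem_diag (T_PI Tgood mT) im; subst m.
case: (leqP #|~: [set x | h x != None]| 1) => [cZ|]; last first.
  case/card_gt1P => t [s []]; rewrite !inE !negbK => /eqP et /eqP es nts.
  by left; apply: total_case nts et es.
right; exists [set x | h x != None] => //.
case: (boolP [forall x in [set x | h x != None], forall y in [set x | h x != None], h x == h y]).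
  move=> /forall_inP hc; have [|->|->] := @bottom_case _ h mT mmin n3 cZ.
  - by move=> x y xZ yZ; have /forall_inP/(_ _ yZ)/eqP := hc x xZ.
  - by constructor 1.
  - by constructor 2.
case/forall_inPn => x xZ /forall_inPn[y yZ nxy].
case: (boolP [exists i in [set x | h x != None], exists j in [set x | h x != None], (i != j) && (h i == h j)]).
  case/exists_inP => i iZ /exists_inP[j jZ /andP[nij /eqP eij]]; constructor 4.
  have [h1 h2 h3 h4] := group_case mT mmin n3 cZ iZ jZ nij eij xZ yZ nxy.
  by exists (diag h).
move=> no; constructor 3; apply: units_case => // i j iZ jZ e.
apply/eqP/negPn/negP => nij; case/negP: no.
by apply/exists_inP; exists i => //; apply/exists_inP; exists j; rewrite // nij e eqxx.
Qed.

End Cases.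

Theorem mainTheorem14 (n : nat) (hn : 3 <= n) (A : {set elt n}) :
  (subsemigroup A /\ isolated A) <->
  (A = Iset n \/ A = Iset n :\: Sset n \/ A = Sset n \/
      (exists2 e, [/\ e \in Iset n, idem e & rank e = n.-1] & A = Gcl e)) \/
      (exists t : 'I_n,
         [\/ A = IYset t, A = IYset t :\: SYset t, A = SYset t
           | exists2 e, [/\ e \in IYset t, idem e & rank e = n.-2] & A = Gcl e]) \/
      (A = PIset n \/ A = PIset n :\: Sset n).
Proof.
have cT : #|~: [set: 'I_n]| <= 1 by rewrite setCT cards0.
have ct (t : 'I_n) : #|~: [set~ t]| <= 1 by rewrite setCK cards1.
have eT : #|[set: 'I_n]|.-1 = n.-1 by rewrite cardsT card_ord.
have et (t : 'I_n) : #|[set~ t]|.-1 = n.-2.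
  by have := cardsC [set t]; rewrite cards1 card_ord => e; rewrite -[in RHS]e.
rewrite Iset_IZ Sset_SZ; split=> [gA|].
  have [?|[Z cZ]] := classification gA hn; first by right; right.
  case: (set_0Vmem (~: Z)) => [e|[t tZ]].
    have -> : Z = [set: 'I_n] by rewrite -[Z]setCK e setC0.
    rewrite eT => -[?|?|?|?]; left; [by left|by right; left|by right; right; left|].
    by right; right; right.
  have -> : Z = [set~ t].
    rewrite -[LHS]setCK; congr (~: _); apply/setP => x; rewrite in_set1.
    apply/idP/eqP => [xZ|->//]; exact: ((card_le1_eqP cZ) t x).
  by rewrite -IYset_IZ -SYset_SZ et => cases; right; left; exists t.
case=> [[->|[->|[->|[e [eI ie re] ->]]]]|[[t]|[->|->]]].
- exact: IZ_isolated_semigroup.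
- exact: IZD_isolated_semigroup.
- exact: SZ_isolated_semigroup.
- by apply: (Gcl_isolated_semigroup cT) => //; rewrite eT.
- rewrite IYset_IZ SYset_SZ => -[->|->|->|[e [eI ie re] ->]].
  + exact: IZ_isolated_semigroup.
  + exact: IZD_isolated_semigroup.
  + exact: SZ_isolated_semigroup.
  + by apply: (Gcl_isolated_semigroup (ct t)) => //; rewrite et.
- exact: PI_isolated_semigroup.
- exact: PID_isolated_semigroup.
Qed.
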